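(* Let $X$ be a quasi-uniform set in $\mathbb{R}^d$. Suppose $\Phi\in L^1_{\mathrm{loc}}(\mathbb{R}^d)$ is a radial basis function satisfying the following two properties. (Property 1') There are a linear operator $T:C_c^k(\mathbb{R}^d)\to C_c(\mathbb{R}^d)$ and a function $G\in L^1_{\mathrm{loc}}(\mathbb{R}^d)$ such that for any $g\in C_c^k(\mathbb{R}^d)$ $$g=\int_{\mathbb{R}^d} Tg(t)\,G(\cdot-t)\,dt,$$ and $G=\Phi*\mu_n+\nu_n$, where $(\mu_n)$ is a sequence of compactly supported, finite Borel measures on $\mathbb{R}^d$ with $\|\mu_n\|$ bounded by a constant, and $(\nu_n)$ is a sequence of finite Borel measures on $\mathbb{R}^d$ with $\|\nu_n\|$ converging to $0$. (Property 2) There exist a kernel of the form $$K(\cdot,t)=\sum_{\xi\in X(t)}A(t,\xi)\,\Phi(\cdot-\xi),$$ where $X(t)\subset B(t,C_0h_X)\cap X$ for a constant $C_0>0$ and $A(\cdot,\xi)\in L^1$ for all $\xi$, and constants $l>d$, $\kappa>0$, $C_E>0$ such that $$|\Phi(x-t)-K(x,t)|\le C_E\,h_X^{\kappa-d}\left(1+\frac{\|x-t\|_2}{h_X}\right)^{-l}\qquad\text{for all }x,t\in\mathbb{R}^d.$$ Let $f\in C_c^k(\mathbb{R}^d)$. Then $$\mathcal{E}(f,S_X(\Phi))_p\le C\,h_X^{\kappa}\,|f|_{W(L^p(\mathbb{R}^d),T)}$$ for any $1\le p\le\infty$, where $C$ denotes a constant.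
   Context: Functions are real valued. $C_c^k(\mathbb{R}^d)$ is the space of compactly supported functions on $\mathbb{R}^d$ with continuous partial derivatives up to order $k$; $C_c=C_c^0$. $L^1_{\mathrm{loc}}(\mathbb{R}^d)$ is the space of measurable functions that are integrable on each bounded measurable set. $B(t,r)$ is the ball of radius $r$ centered at $t$. For a finite Borel measure $\mu$, $\|\mu\|=|\mu|(\mathbb{R}^d)$, where $|\mu|$ is the total variation of $\mu$. A radial basis function (RBF) is a radial function on $\mathbb{R}^d$. For a countable set $X\subset\mathbb{R}^d$, the fill distance is $h_X=\sup_{x\in\mathbb{R}^d}\inf_{\xi\in X}\|x-\xi\|_2$, the separation radius is $q_X=\frac12\inf_{\xi,\xi'\in X,\,\xi\ne\xi'}\|\xi-\xi'\|_2$, and the mesh ratio is $\rho_X=h_X/q_X$. The set $X$ (with $h_X<\infty$ and $q_X>0$) is quasi-uniform if $\rho_X$ is bounded by a constant. The RBF approximation space is $$S_X(\Phi)=\Big\{\sum_{\xi\in Y}a_\xi\Phi(\cdot-\xi):\ Y\subset X,\ \#Y<\infty\Big\}\cap L^1(\mathbb{R}^d),$$ with real coefficients $a_\xi$, and the approximation error is $\mathcal{E}(f,S_X(\Phi))_p=\inf_{S\in S_X(\Phi)}\|f-S\|_{L^p(\mathbb{R}^d)}$. The semi-norm is $|f|_{W(L^p(\mathbb{R}^d),T)}=\|Tf\|_p$. *)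

(* Defs.v *)
From HB Require Import structures.
From mathcomp Require Import all_boot all_order all_algebra.
From mathcomp Require Import all_classical all_reals all_analysis.
From mathcomp Require Import measurable_realfun ess_sup_inf.

Set Implicit Arguments.
Unset Strict Implicit.
Unset Printing Implicit Defensive.

Import Order.TTheory GRing.Theory Num.Theory.
Import numFieldNormedType.Exports.

Local Open Scope classical_set_scope.
Local Open Scope ring_scope.

Section borel.
Variables (R : realType) (m n : nat).

HB.instance Definition _ := @isMeasurable.Build default_measure_display
  'M[R]_(m, n) <<s @open 'M[R]_(m, n) >>
  (@sigma_algebra0 _ setT _) (@sigma_algebraC _ _)
  (@sigma_algebra_bigcup _ setT _).

Lemma open_measurable_mx (U : set 'M[R]_(m, n)) : open U -> measurable U.
Proof. exact: sub_sigma_algebra. Qed.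

Lemma measurable_fun_coord (i : 'I_m) (j : 'I_n) :
  measurable_fun [set: 'M[R]_(m, n)] (fun x : 'M[R]_(m, n) => x i j).
Proof.
apply: (measurability _ (RGenOpens.measurableE R)).
move=> /= _ [_ [a [b ->] <-]]; rewrite setTI; apply: open_measurable_mx.
move/continuousP : (@coord_continuous R m n i j); apply; exact: interval_open.
Qed.

Lemma measurable_fun_mx d (T : measurableType d) (f : T -> 'M[R]_(m, n)) :
  (forall i j, measurable_fun [set: T] (fun x => f x i j)) ->
  measurable_fun [set: T] f.
Proof.
move=> mf.
have mball (q : 'M[R]_(m, n)) (e : R) : measurable (f @^-1` ball q e).
  have [e0|e0] := ltP 0 e; last first.
    rewrite (_ : _ @^-1` _ = set0)//; apply/seteqP; split => // t [].
    by rewrite ltNge e0.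
  rewrite (_ : _ @^-1` _ = \bigcap_(ij in [set: 'I_m * 'I_n])
      ((fun x => f x ij.1 ij.2) @^-1` ball (q ij.1 ij.2) e)).
    apply: fin_bigcap_measurable => // ij _; rewrite -[X in measurable X]setTI.
    by apply: mf => //; apply: open_measurable; exact: ball_open.
  apply/seteqP; split => [t [_ qt] ij _|t qt]; first exact: qt.
  by split => // i j; exact: (qt (i, j)).
apply: (measurability (@open 'M[R]_(m, n))) => // _ [U oU <-].
rewrite setTI.
pose Q := ('M[rat]_(m, n) * nat)%type.
pose c (q : Q) : 'M[R]_(m, n) := map_mx ratr q.1.
pose B (q : Q) : set 'M[R]_(m, n) := ball (c q) q.2.+1%:R^-1.
have -> : f @^-1` U =
    \bigcup_(q : Q) (if `[< B q `<=` U >] then f @^-1` B q else set0).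
  apply/seteqP; split => [t Uft|t [q _]]; last first.
    by case: asboolP => // qU /qU.
  move: oU; rewrite openE => /(_ _ Uft)/nbhs_ballP[e/= e0 eU].
  have [k ke] : exists k : nat, k.+1%:R^-1 < e / 2.
    have /ltr_add_invr [k] : (0 : R) < e / 2 by rewrite divr_gt0.
    by rewrite add0r => ?; exists k.
  have k0 : (0 : R) < k.+1%:R^-1 by [].
  have ex i j : exists q : rat, ball (f t i j) (k.+1%:R^-1 : R) (ratr q).
    have [r [Br [q _ qr]]] := @dense_rat R (ball (f t i j) (k.+1%:R^-1 : R))
      (ex_intro _ _ (ballxx _ k0)) (ball_open _ _).
    by exists q; rewrite qr.
  have [q qP] : {q : 'I_m * 'I_n -> rat & forall ij,
      ball (f t ij.1 ij.2) (k.+1%:R^-1 : R) (ratr (q ij))}.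
    apply: (@choice _ _ (fun ij q =>
      ball (f t ij.1 ij.2) (k.+1%:R^-1 : R) (ratr q))) => -[i j]; exact: ex.
  have Bq : B (\matrix_(i, j) q (i, j), k) (f t).
    split => [//|i j]; rewrite /c !mxE; apply: ball_sym; exact: (qP (i, j)).
  exists (\matrix_(i, j) q (i, j), k) => //; case: asboolP => // -[] y By.
  apply: eU; rewrite [e]splitr.
  apply: (@ball_triangle _ _ (c (\matrix_(i, j) q (i, j), k))).
    by apply: ball_sym; apply: le_ball Bq; exact: ltW.
  by apply: le_ball By; exact: ltW.
apply: countable_bigcupT_measurable; first exact: countableP.
by move=> q; case: ifP => // _; exact: mball.
Qed.

End borel.

Section lebesgue_cons.
Variables (R : realType) (d : nat).
Variable m : {sigma_finite_measure set 'rV[R]_d -> \bar R}.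
Local Open Scope ereal_scope.

Let cons (xy : measurableTypeR R * 'rV[R]_d) : 'rV[R]_(1 + d) :=
  row_mx (const_mx xy.1) xy.2.

Let mcons : measurable_fun [set: measurableTypeR R * 'rV[R]_d] cons.
Proof.
apply: measurable_fun_mx => i j; rewrite /cons.
case: (split_ordP j) => k ->.
  by under eq_fun do rewrite row_mxEl mxE; exact: measurable_fst.
under eq_fun do rewrite row_mxEr.
exact: (measurableT_comp (measurable_fun_coord i k) measurable_snd).
Qed.

Definition lebesgue_cons : set 'rV[R]_(1 + d) -> \bar R :=
  pushforward (@lebesgue_measure R \x m) cons.

Let lebesgue_cons0 : lebesgue_cons set0 = 0.
Proof. by rewrite /lebesgue_cons /pushforward preimage_set0 measure0. Qed.

Let lebesgue_cons_ge0 A : 0 <= lebesgue_cons A.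
Proof. exact: measure_ge0. Qed.

Let lebesgue_cons_sigma_additive : semi_sigma_additive lebesgue_cons.
Proof.
pose mu := measure_function_pushforward__canonical__measure_function_Measure
  (@lebesgue_measure R \x m) mcons.
exact: (@measure_semi_sigma_additive _ _ _ mu).
Qed.

HB.instance Definition _ := isMeasure.Build _ _ _ lebesgue_cons
  lebesgue_cons0 lebesgue_cons_ge0 lebesgue_cons_sigma_additive.

Let lebesgue_cons_sigma_finite : sigma_finite setT lebesgue_cons.
Proof.
have /sigma_finiteP[F [TF ndF Foo]] := sigma_finiteT (@lebesgue_measure R).
have /sigma_finiteP[G [TG ndG Goo]] := sigma_finiteT m.
pose inv (x : 'rV[R]_(1 + d)) : measurableTypeR R * 'rV[R]_d :=
  (lsubmx x 0%R 0%R, rsubmx x).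
have consK : cancel cons inv.
  move=> [x y]; rewrite /inv /cons /= row_mxKl row_mxKr mxE//.
have minv : measurable_fun setT inv.
  apply: measurable_fun_pair.
    have -> : (fun x : 'rV[R]_(1 + d) => lsubmx x 0%R 0%R) =
        (fun x => x 0%R (lshift d 0%R)) by apply/funext => x; rewrite mxE.
    exact: measurable_fun_coord.
  apply: measurable_fun_mx => i j.
  have -> : (fun x : 'rV[R]_(1 + d) => rsubmx x i j) =
      (fun x => x i (rshift 1 j)) by apply/funext => x; rewrite mxE.
  exact: measurable_fun_coord.
exists (fun n => inv @^-1` (F n `*` G n)).
  rewrite -preimage_bigcup -(preimage_setT inv); congr (_ @^-1` _).
  rewrite -setXTT TF TG predeqE => -[x y]; split.
    move=> [/= [n _ Fnx] [k _ Gky]]; exists (maxn n k) => //; split.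
    - by move: x Fnx; exact/subsetPset/ndF/leq_maxl.
    - by move: y Gky; exact/subsetPset/ndG/leq_maxr.
  by move=> [n _ []/= ? ?]; split; exists n.
move=> n; have [mF Fnoo] := Foo n; have [mG Gnoo] := Goo n; split.
  by rewrite -[X in measurable X]setTI; apply: minv => //; exact: measurableX.
rewrite /lebesgue_cons /pushforward -comp_preimage (_ : inv \o cons = id).
  by rewrite preimage_id product_measure1E// lte_mul_pinfty// ge0_fin_numE.
by apply/funext => z /=.
Qed.

HB.instance Definition _ := Measure_isSigmaFinite.Build _ _ _ lebesgue_cons
  lebesgue_cons_sigma_finite.

End lebesgue_cons.

Fixpoint lebesgue (R : realType) (d : nat) :
    {sigma_finite_measure set 'rV[R]_d -> \bar R} :=
  match d with
  | 0 => dirac (0 : 'rV[R]_0)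
  | d'.+1 => lebesgue_cons (lebesgue R d')
  end.

Lemma lebesgue_box (R : realType) (d : nat) (A : 'I_d -> set R) :
  (forall i, measurable (A i)) ->
  lebesgue R d [set x : 'rV[R]_d | forall i, A i (x 0 i)] =
  (\prod_(i < d) @lebesgue_measure R (A i))%E.
Proof.
elim: d A => [|d IH] A mA.
  by rewrite big_ord0 /= diracE mem_set// => -[].
transitivity ((@lebesgue_measure R \x lebesgue R d)%E
    (A ord0 `*` [set x : 'rV[R]_d | forall i, A (lift ord0 i) (x 0 i)]));
  last first.
  rewrite big_ord_recl product_measure1E//=.
    by congr (_ * _)%E; exact: (IH (fun i => A (lift ord0 i))).
    exact: mA.
  rewrite (_ : [set x : 'rV[R]_d | _] = \bigcap_(i in [set: 'I_d])
    ((fun x : 'rV[R]_d => x 0 i) @^-1` A (lift ord0 i))).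
    apply: fin_bigcap_measurable => // i _; rewrite -[X in measurable X]setTI.
    exact: measurable_fun_coord.
  by apply/seteqP; split => x /= xA i; [move=> _; exact: xA|exact: xA].
have l0 : ord0 = lshift d (ord0 : 'I_1) :> 'I_(1 + d) by exact/val_inj.
have lS (i : 'I_d) : lift ord0 i = rshift 1 i :> 'I_(1 + d) by exact/val_inj.
have c0 (x : R) (y : 'rV[R]_d) :
    row_mx (const_mx x) y 0 (ord0 : 'I_(1 + d)) = x.
  by rewrite l0 row_mxEl mxE.
have cS (x : R) (y : 'rV[R]_d) (i : 'I_d) :
    row_mx (const_mx x) y 0 (lift ord0 i : 'I_(1 + d)) = y 0 i.
  by rewrite lS row_mxEr.
congr (product_measure1 _ _ _); apply/seteqP; split => -[x y] /=.
  move=> xyA; split; first by rewrite -[x](c0 x y); exact: xyA.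
  by move=> i; rewrite -(cS x y); exact: xyA.
move=> [Ax Ay] i; case: (unliftP ord0 i) => [j|] ->.
  by have := Ay j; rewrite -(cS x y).
by rewrite -[x](c0 x y) in Ax.
Qed.

Section signed_measure.
Context d (T : measurableType d) (R : realType).
Implicit Types (nu : {charge set T -> \bar R}) (f : T -> \bar R).
Local Open Scope ereal_scope.

Lemma hahn_exists nu :
  exists PN : set T * set T, hahn_decomposition nu PN.1 PN.2.
Proof. by have [P [N nuPN]] := Hahn_decomposition nu; exists (P, N). Qed.

(* The Hahn decomposition is unique only up to null sets; the measures below do
   not depend on the one that is chosen. *)
Definition hahn nu := svalP (cid (hahn_exists nu)).

Definition total_variation nu : set T -> \bar R := charge_variation (hahn nu).

Definition tv_norm nu : \bar R := total_variation nu [set: T].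

Definition charge_integral nu f : \bar R :=
  \int[jordan_pos (hahn nu)]_x f x - \int[jordan_neg (hahn nu)]_x f x.

End signed_measure.

Section function_spaces.
Variables (R : realType) (d : nat).
Implicit Types (f g Phi : 'rV[R]_d -> R).

Fixpoint continuously_derivable (k : nat) f : Prop :=
  match k with
  | 0 => continuous f
  | k'.+1 => continuous f /\ forall i : 'I_d,
      (forall x, derivable f x (delta_mx 0 i)) /\
      continuously_derivable k' (fun x => 'D_(delta_mx 0 i) f x)
  end.

Definition Cc (k : nat) : set ('rV[R]_d -> R) :=
  [set f | continuously_derivable k f /\ compact (closure [set x | f x != 0])].

Definition L1 : set ('rV[R]_d -> R) :=
  [set f | (lebesgue R d).-integrable setT (EFin \o f)].

Definition L1loc : set ('rV[R]_d -> R) :=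
  [set f | measurable_fun setT f /\
    forall A : set 'rV[R]_d, measurable A -> bounded_set A ->
      (lebesgue R d).-integrable A (EFin \o f)].

(* The library norm on ['rV[R]_d] is the sup norm; it has the same topology and
   the same bounded sets. *)
Definition enorm (x : 'rV[R]_d) : R := Num.sqrt (\sum_(i < d) x 0 i ^+ 2).

Definition radial f := exists phi : R -> R, forall x, f x = phi (enorm x).

Definition linear_on (D : set ('rV[R]_d -> R))
    (T : ('rV[R]_d -> R) -> ('rV[R]_d -> R)) :=
  forall (a : R) f g, D f -> D g ->
    T (fun x => a * f x + g x) = (fun x => a * T f x + T g x).

End function_spaces.

Section scattered_sets.
Variables (R : realType) (d : nat).
Implicit Types (X : set 'rV[R]_d).
Local Open Scope ereal_scope.

(* Extended real: both infima are +oo over an empty index set. *)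
Definition fill_distance X : \bar R :=
  ereal_sup [set ereal_inf [set (enorm (x - xi))%:E | xi in X]
            | x in [set: 'rV[R]_d]].

Definition separation_radius X : \bar R :=
  2^-1%:E * ereal_inf [set (enorm (xi.1 - xi.2))%:E
                      | xi in [set xi | [/\ X xi.1, X xi.2 & xi.1 <> xi.2]]].

Definition mesh_ratio X : \bar R := fill_distance X / separation_radius X.

Definition quasi_uniform (rho0 : R) X :=
  [/\ countable X, fill_distance X < +oo, 0 < separation_radius X
    & mesh_ratio X <= rho0%:E].

Definition hfill X : R := fine (fill_distance X).

End scattered_sets.

Section rbf_approximation.
Variables (R : realType) (d : nat).
Implicit Types (f G Phi : 'rV[R]_d -> R) (X : set 'rV[R]_d).
Local Notation leb := (lebesgue R d).

Definition rbf_space X Phi : set ('rV[R]_d -> R) :=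
  [set S | exists (Y : set 'rV[R]_d) (a : 'rV[R]_d -> R),
    [/\ finite_set Y, Y `<=` X
      & S = fun x => \sum_(xi \in Y) a xi * Phi (x - xi)]] `&` @L1 R d.

Definition approx_error (p : \bar R) f X Phi : \bar R :=
  ereal_inf [set Lnorm leb p (EFin \o (f \- S)) | S in rbf_space X Phi].

Definition convolution Phi (mu : {charge set 'rV[R]_d -> \bar R}) :
    'rV[R]_d -> \bar R :=
  fun x => charge_integral mu (fun t => (Phi (x - t))%:E).

Definition compactly_supported (mu : {charge set 'rV[R]_d -> \bar R}) :=
  exists2 K : set 'rV[R]_d, compact K & total_variation mu (~` K) = 0%E.

(* [G = Phi * mu + nu]: as [nu] need not have a density, this is an identity
   between set functions on the bounded Borel sets, a locally integrable
   function standing for the set function [A |-> \int_A]. *)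
Definition eq_convolution_plus G Phi
    (mu nu : {charge set 'rV[R]_d -> \bar R}) :=
  forall A : set 'rV[R]_d, measurable A -> bounded_set A ->
    (\int[leb]_(x in A) (G x)%:E =
     (\int[leb]_(x in A) convolution Phi mu x) + nu A)%E.

Definition property1 (k : nat) Phi (T : ('rV[R]_d -> R) -> ('rV[R]_d -> R)) :=
  [/\ forall g, Cc k g -> Cc 0 (T g),
      linear_on (Cc k) T &
      exists2 G, L1loc G &
        (forall g, Cc k g -> forall x,
          (g x)%:E = (\int[leb]_t (T g t * G (x - t))%:E)%E) /\
        exists (mu nu : nat -> {charge set 'rV[R]_d -> \bar R}),
          [/\ forall n, compactly_supported (mu n),
              exists M : R, forall n, (tv_norm (mu n) <= M%:E)%E,
              (fun n => tv_norm (nu n)) @ \oo --> 0%E &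
              forall n, eq_convolution_plus G Phi (mu n) (nu n)]].

Definition property2 (C0 l kappa CE : R) X Phi :=
  exists (Xt : 'rV[R]_d -> set 'rV[R]_d) (A : 'rV[R]_d -> 'rV[R]_d -> R),
    [/\ forall t, Xt t `<=` X `&` [set xi | enorm (xi - t) <= C0 * hfill X],
        forall xi, X xi -> L1 (fun t => A t xi) &
        forall x t,
          `|Phi (x - t) - \sum_(xi \in Xt t) A t xi * Phi (x - xi)| <=
          CE * hfill X `^ (kappa - d%:R)
             * (1 + enorm (x - t) / hfill X) `^ (- l)].

End rbf_approximation.

(* Main.v *)
From HB Require Import structures.
Require Import Defs.
From mathcomp Require Import all_boot all_order all_algebra.
From mathcomp Require Import all_classical all_reals all_analysis.
From mathcomp Require Import measurable_realfun ess_sup_inf.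
From mathcomp Require Import lra.
Import Order.TTheory GRing.Theory Num.Theory.
Import numFieldNormedType.Exports.
Local Open Scope classical_set_scope.
Local Open Scope ring_scope.
Set Implicit Arguments.
Unset Strict Implicit.
Unset Printing Implicit Defensive.

(** Write [u = T f], so that [f = u * G], and let [h] be the fill distance of
    [X]. Inserting [G = Phi * mu_n + nu_n] gives

      f = Phi * (u * mu_n) + u * nu_n.

    The L^p norm of the second term is at most [|nu_n| |u|_p], by Young's
    inequality for measures, and one [n] with [|nu_n| <= h^kappa] is enough. In
    the first term [Phi] is integrated against [w = u * mu_n], a bounded function
    of bounded support. Replacing [Phi (x - t)] by the kernel [K x t] in this
    integral leaves a finite combination of translates of [Phi] by points of [X],
    finite because a separated set has finitely many points in a bounded region.
    The error committed at [x] is at most [(|w| * E) x], where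

      E y = CE h^(kappa - d) (1 + |y| / h)^(- l),

    and Young's inequality bounds its L^p norm by [|E|_1 |mu_n| |u|_p]. As
    [d < l], [|E|_1] is at most a constant times [h^kappa]. The same bound with
    [p = 1] shows that the approximant is integrable, since [f] is.

    The splitting of [f] is [reproduction_split], the replacement of [Phi] by [K]
    is [quasi_interpolation], the norm of [E] comes from [integral_decay], and
    [young] is the inequality used for both error terms; they are put together in
    [exists_approximant].

    Two points need an argument of their own. First, [G = Phi * mu_n + nu_n] is an
    identity between set functions, since [nu_n] may have no density;
    [Rintegral_charge_density] extends it to integrals of bounded functions.
    Second, the sets [X(t)] need not depend measurably on [t], so that the
    coefficients of [K] cannot be integrated as they stand. For [t] in a bounded
    region, however, [X(t)] is one of the finitely many subsets of a fixed finite
    set, and the estimate of Property 2 is convex in the coefficients. Averaging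
    the coefficients over all subsets for which that estimate holds at [t] yields
    measurable coefficients for which it still holds; this is
    [measurable_selection]. *)

(** * Integration *)

Section bounded_functions.
Context d (T : measurableType d) (R : realType).
Variables (mu : {measure set T -> \bar R}) (D : set T) (w : T -> R) (B : R).
Hypotheses (mD : measurable D) (mw : measurable_fun setT w).
Hypothesis wB : forall x, `|w x| <= B.

Let w_bounded : [bounded w x | x in D].
Proof.
exists B; split; first exact: num_real.
by move=> M BM x _ /=; rewrite (le_trans (wB x))// ltW.
Qed.

Lemma bounded_integrable : (mu D < +oo)%E -> mu.-integrable D (EFin \o w).
Proof.
by move=> muD; apply: measurable_bounded_integrable => //; exact: measurable_funTS.
Qed.

Lemma bounded_integrableM (h : T -> R) : mu.-integrable D (EFin \o h) ->
  mu.-integrable D (EFin \o (fun x => w x * h x)).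
Proof.
move=> ih; rewrite (_ : EFin \o _ = ((EFin \o w) \* (EFin \o h))%E)//.
by apply: integrableMr => //; exact: measurable_funTS.
Qed.

End bounded_functions.

Lemma finite_measure_lty d (T : measurableType d) (R : realType)
    (m : {finite_measure set T -> \bar R}) (D : set T) :
  measurable D -> (m D < +oo)%E.
Proof. by move=> mD; rewrite -ge0_fin_numE//; exact: fin_num_measure. Qed.

Lemma integrable_Rsum dd (T : measurableType dd) (R : realType)
    (m : {measure set T -> \bar R}) (I : Type) (s : seq I) (f : I -> T -> R) :
  (forall i, m.-integrable setT (EFin \o f i)) ->
  m.-integrable setT (EFin \o (fun t => \sum_(i <- s) f i t)).
Proof.
move=> fi.
have := @integrable_sum _ T R m setT measurableT I s xpredT
  (fun i => EFin \o f i) (fun i _ => fi i).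
by apply: eq_integrable => // t _; rewrite /= sumEFin.
Qed.

Lemma Rintegral_sum dd (T : measurableType dd) (R : realType)
    (m : {measure set T -> \bar R}) (I : Type) (s : seq I) (f : I -> T -> R) :
  (forall i, m.-integrable setT (EFin \o f i)) ->
  \int[m]_t (\sum_(i <- s) f i t) = \sum_(i <- s) \int[m]_t f i t.
Proof.
move=> fi; elim: s => [|i s IH].
  by rewrite big_nil; under eq_Rintegral do rewrite big_nil; rewrite Rintegral_cst// mul0r.
under eq_Rintegral do rewrite big_cons.
by rewrite RintegralD// ?IH ?big_cons//; exact: integrable_Rsum.
Qed.

Section Lnorm_monotone.
Context dd (T : measurableType dd) (R : realType).
Variables (m : {measure set T -> \bar R}).

Lemma ae_le_Lnorm (F g : T -> R) (p : \bar R) :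
  measurable_fun setT F -> measurable_fun setT g ->
  {ae m, forall x, `|F x| <= g x} -> (1 <= p)%E ->
  (Lnorm m p (EFin \o F) <= Lnorm m p (EFin \o g))%E.
Proof.
move=> mF mg Fg; rewrite unlock; case: p => [r r1|_|//] /=; last first.
  case: ifP => // _; apply: le_ess_sup; apply: filterS Fg => x xFg /=.
  by rewrite lee_fin (le_trans xFg)// ler_norm.
have r0 : 0 < r by move: r1; rewrite lee_fin; lra.
have mpow (k : T -> R) : measurable_fun setT k -> measurable_fun setT (fun x => (`|k x| `^ r)%:E).
  move=> mk; apply/measurable_EFinP.
  by apply: (measurableT_comp (measurable_powR r)); exact: measurableT_comp.
have I0 (k : T -> R) : (0 <= \int[m]_x (`|k x| `^ r)%:E)%E.
  by apply: integral_ge0 => x _; rewrite lee_fin powR_ge0.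
have pos (z : \bar R) : (0 <= z)%E -> z \in `[0%E, +oo%E] by move=> z0; rewrite in_itv/= z0 leey.
apply: gt0_ler_poweR; rewrite ?pos ?I0 ?invr_ge0 ?(ltW r0)//.
apply: ae_ge0_le_integral => //; try by move=> x _; rewrite lee_fin powR_ge0.
- exact: mpow.
- exact: mpow.
apply: filterS Fg => x xFg _; rewrite lee_fin ge0_ler_powR ?nnegrE ?(ltW r0)//.
by rewrite (le_trans xFg)// ler_norm.
Qed.

End Lnorm_monotone.

Section null_sections.
Context d1 d2 (T1 : measurableType d1) (T2 : measurableType d2) (R : realType).
Variables (m1 : {sigma_finite_measure set T1 -> \bar R}).
Variables (m2 : {sigma_finite_measure set T2 -> \bar R}).
Local Open Scope ereal_scope.

(** By Tonelli, either condition says that [N] is null for the product measure. *)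
Lemma ae_null_xsection (N : set (T1 * T2)) : measurable N ->
  (forall y, m1 (ysection N y) = 0) -> {ae m1, forall x, m2 (xsection N x) = 0}.
Proof.
move=> mN N0.
have := indic_fubini_tonelli m1 m2 mN.
rewrite indic_fubini_tonelli_FE// indic_fubini_tonelli_GE//.
rewrite [RHS]integral0_eq; last by move=> y _ /=.
move=> I0.
have mX : measurable_fun setT (m2 \o xsection N) by exact: measurable_fun_xsection.
have /(ae_eq_integral_abs m1 measurableT mX) : \int[m1]_x `|(m2 \o xsection N) x| = 0.
  by rewrite -[RHS]I0; apply: eq_integral => x _; rewrite gee0_abs.
by apply: filterS => x /= /(_ Logic.I).
Qed.

End null_sections.

Section density.
Context d (T : measurableType d) (R : realType).
Variables (mu : {measure set T -> \bar R}) (g : T -> R).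
Local Open Scope ereal_scope.
Hypotheses (g0 : forall x, (0 <= g x)%R) (mg : measurable_fun setT g).

(** The hypotheses on [g] are arguments so that the measure structure can be
    inferred from the term itself. *)
Definition density of (forall x, (0 <= g x)%R) & measurable_fun setT g :=
  fun A => \int[mu]_(x in A) (g x)%:E.

Local Notation dg := (density g0 mg).

Let density0 : dg set0 = 0.
Proof. by rewrite /density integral_set0. Qed.

Let density_ge0 A : 0 <= dg A.
Proof. by apply: integral_ge0 => x _; rewrite lee_fin. Qed.

Let density_sigma_additive : semi_sigma_additive dg.
Proof.
move=> F mF tF mUF; rewrite /density ge0_integral_bigcup//; last 2 first.
- by apply/measurable_EFinP; exact: measurable_funTS.
- by move=> x _; rewrite lee_fin.
by apply: is_cvg_nneseries => n _ _; exact: density_ge0.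
Qed.

HB.instance Definition _ := isMeasure.Build _ _ _ dg
  density0 density_ge0 density_sigma_additive.

Import HBNNSimple.

(** Linearity settles simple functions, and monotone convergence the rest. *)
Lemma ge0_integral_density (D : set T) (f : T -> \bar R) :
  measurable D -> measurable_fun D f -> (forall x, 0 <= f x) ->
  \int[dg]_(x in D) f x = \int[mu]_(x in D) (f x * (g x)%:E).
Proof.
move=> mD mf f0; pose h := nnsfun_approx mD mf.
have mgD : measurable_fun D (EFin \o g).
  by apply/measurable_EFinP; exact: measurable_funTS.
have -> : \int[dg]_(x in D) f x =
    lim (\int[dg]_(x in D) (EFin \o h n) x @[n --> \oo]).
  have fE x : D x -> f x = lim ((EFin \o h n) x @[n --> \oo]).
    by move=> Dx; apply/esym/cvg_lim => //; exact: cvg_nnsfun_approx.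
  under eq_integral => x /[!inE] /fE -> //.
  apply: monotone_convergence => //.
  - by move=> n; apply/measurable_EFinP; exact: measurable_funTS.
  - by move=> n x Dx //=; rewrite lee_fin.
  - by move=> x Dx a b ab; rewrite lee_fin; exact/lefP/nd_nnsfun_approx.
have -> : \int[mu]_(x in D) (f \* (EFin \o g)) x =
    lim (\int[mu]_(x in D) ((EFin \o g) \* (EFin \o h n)) x @[n --> \oo]).
  rewrite -monotone_convergence//.
  - apply: eq_integral => x /[!inE] Dx /=; apply/esym/cvg_lim => //.
    by rewrite muleC; apply: cvgeZl => //; exact: cvg_nnsfun_approx.
  - by move=> n; apply: emeasurable_funM => //; apply/measurable_EFinP; exact: measurable_funTS.
  - by move=> n x Dx; rewrite mule_ge0// lee_fin.
  - by move=> x Dx a b ab; rewrite lee_wpmul2l ?lee_fin//; exact/lefP/nd_nnsfun_approx.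
congr (limn _); apply/funext => n.
transitivity (\int[dg]_(x in D)
   (\sum_(y \in range (h n)) (y * \1_(h n @^-1` [set y]) x)%:E)).
  by apply: eq_integral => t tD; rewrite /= fimfunE -fsumEFin.
have indich m r : measurable_fun D (fun x => (r * \1_(h m @^-1` [set r]) x)%:E).
  by apply: (measurable_comp measurableT) => //; exact: measurable_funM.
rewrite ge0_integral_fsum//; last by move=> m y Ey; exact: nnfun_muleindic_ge0.
transitivity (\int[mu]_(x in D) (\sum_(y \in range (h n))
    (y * \1_(h n @^-1` [set y]) x)%:E * (g x)%:E)); last first.
  apply: eq_integral => x xD /=.
  rewrite -ge0_mule_fsuml => [|y]; last exact: nnfun_muleindic_ge0.
  by rewrite fsumEFin // -(fimfunE _ x) muleC.
rewrite ge0_integral_fsum//; last 2 first.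
  - by move=> y; apply: emeasurable_funM.
  - by move=> m y Ey; rewrite mule_ge0 ?lee_fin// -lee_fin nnfun_muleindic_ge0.
apply: eq_fsbigr => r rhn.
under eq_integral do rewrite EFinM.
rewrite integralZl_indic_nnsfun//.
under [RHS]eq_integral do rewrite EFinM -muleA.
rewrite ge0_integralZl//.
- congr (_ * _); rewrite integral_indic//.
  under eq_integral do rewrite muleC.
  rewrite (eq_integral ((EFin \o g) \_ (h n @^-1` [set r]))); last first.
    by move=> x xD; rewrite epatch_indic.
  by rewrite -integral_mkcondr setIC.
- by apply: emeasurable_funM => //; exact/measurable_EFinP.
- by move=> t Et; rewrite mule_ge0 ?lee_fin.
- by move: rhn; rewrite inE => -[t _ <-]; rewrite lee_fin.
Qed.

End density.

Section charge_density.
Context d (T : measurableType d) (R : realType).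
Variables (mu : {measure set T -> \bar R}) (n1 n2 : {finite_measure set T -> \bar R}).
Variables (D : set T) (H : T -> R).
Hypotheses (mD : measurable D) (mH : measurable_fun setT H).
Hypothesis (iH : mu.-integrable D (EFin \o H)).
Hypothesis HE : forall A, measurable A -> A `<=` D ->
  (\int[mu]_(x in A) (H x)%:E = n1 A - n2 A)%E.

(** Once the negative terms have changed sides, [HE] says that the measures
    [H^\+ mu + n2] and [H^\- mu + n1] agree on the subsets of [D]. *)
Let nonneg_case (v : T -> R) : measurable_fun setT v ->
  (forall x, 0 <= v x) -> (exists B, forall x, `|v x| <= B) ->
  \int[mu]_(x in D) (v x * H x) = \int[n1]_(x in D) v x - \int[n2]_(x in D) v x.
Proof.
move=> mv v0 [B vB].
have mHp : measurable_fun setT (H^\+)%R by exact: measurable_funrpos.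
have mHn : measurable_fun setT (H^\-)%R by exact: measurable_funrneg.
have iHp := integrable_funrpos mD iH.
have iHn := integrable_funrneg mD iH.
have Hp0 := funrpos_ge0 H.
have Hn0 := funrneg_ge0 H.
have HpnE x : H x = (H^\+)%R x - (H^\-)%R x by rewrite -[in LHS](funrposBneg H).
pose m1 := measure_add (density mu Hp0 mHp) n2.
pose m2 := measure_add (density mu Hn0 mHn) n1.
have m12 : (\int[m1]_(x in D) (v x)%:E = \int[m2]_(x in D) (v x)%:E)%E.
  apply: eq_measure_integral => A mA AD.
  have iHA := integrableS mD mA AD iH.
  have iHpA := integrableS mD mA AD iHp.
  have iHnA := integrableS mD mA AD iHn.
  rewrite [LHS](measure_addE (density mu Hp0 mHp) n2)
    [RHS](measure_addE (density mu Hn0 mHn) n1) /=.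
  have := HE mA AD.
  under eq_integral do rewrite HpnE EFinB.
  rewrite integralB// => E.
  have f1 : (density mu Hp0 mHp A \is a fin_num)%E := integrable_fin_num mA iHpA.
  have f2 : (density mu Hn0 mHn A \is a fin_num)%E := integrable_fin_num mA iHnA.
  have f3 : n1 A \is a fin_num by exact: fin_num_measure.
  have f4 : n2 A \is a fin_num by exact: fin_num_measure.
  move: E; rewrite -/(density mu Hp0 mHp A) -/(density mu Hn0 mHn A).
  rewrite -(fineK f1) -(fineK f2) -(fineK f3) -(fineK f4) -!EFinB -!EFinD.
  by move=> [E]; congr EFin; lra.
move: m12; rewrite !ge0_integral_measure_add//; last 4 first.
- by move=> x _; rewrite lee_fin.
- by apply/measurable_EFinP; exact: measurable_funTS.
- by move=> x _; rewrite lee_fin.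
- by apply/measurable_EFinP; exact: measurable_funTS.
have mvD : measurable_fun D (EFin \o v) by apply/measurable_EFinP; exact: measurable_funTS.
rewrite !ge0_integral_density//; [|by move=> x; rewrite lee_fin..].
have ip := bounded_integrableM mD mv vB iHp.
have in_ := bounded_integrableM mD mv vB iHn.
have i1 := bounded_integrable mD mv vB (finite_measure_lty n1 mD).
have i2 := bounded_integrable mD mv vB (finite_measure_lty n2 mD).
have -> : \int[mu]_(x in D) (v x * H x) =
    \int[mu]_(x in D) (v x * (H^\+)%R x) - \int[mu]_(x in D) (v x * (H^\-)%R x).
  rewrite -RintegralB//; apply: eq_Rintegral => x _.
  by rewrite -mulrBr -HpnE.
rewrite /Rintegral.
have f1 : (\int[mu]_(x in D) (v x * (H^\+)%R x)%:E \is a fin_num)%E.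
  exact: integrable_fin_num.
have f2 : (\int[mu]_(x in D) (v x * (H^\-)%R x)%:E \is a fin_num)%E.
  exact: integrable_fin_num.
have f3 : (\int[n1]_(x in D) (v x)%:E \is a fin_num)%E.
  exact: integrable_fin_num.
have f4 : (\int[n2]_(x in D) (v x)%:E \is a fin_num)%E.
  exact: integrable_fin_num.
move=> E.
have {E} : (fine (\int[mu]_(x in D) (v x * (H^\+)%R x)%:E + \int[n2]_(x in D) (v x)%:E) =
  fine (\int[mu]_(x in D) (v x * (H^\-)%R x)%:E + \int[n1]_(x in D) (v x)%:E))%E.
  by congr fine; exact: E.
rewrite (fineD f1 f4) (fineD f2 f3).
set a := fine _; set b := fine _; set c := fine _; set e := fine _ => E.
lra.
Qed.

(** From sets to bounded functions: this is what gives an integral identity when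
    the density of a charge is known only through its values on sets. *)
Lemma Rintegral_charge_density (w : T -> R) (B : R) : measurable_fun setT w ->
  (forall x, `|w x| <= B) ->
  \int[mu]_(x in D) (w x * H x) = \int[n1]_(x in D) w x - \int[n2]_(x in D) w x.
Proof.
move=> mw wB.
(* the two sides are linear in the weight, and [w] differs from a nonnegative
   weight by the constant [B] *)
pose v x := w x + B.
pose b (x : T) := B.
have v0 x : 0 <= v x by move: (wB x); rewrite ler_norml /v; lra.
have b0 x : 0 <= b x by rewrite (le_trans _ (wB x)).
have mv : measurable_fun setT v by apply: measurable_funD.
have mb : measurable_fun setT b by exact: measurable_cst.
have vB x : `|v x| <= B + B.
  by rewrite ger0_norm//; move: (wB x); rewrite ler_norml /v; lra.
have bB x : `|b x| <= B by rewrite ger0_norm.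
have := nonneg_case mv v0 (ex_intro _ _ vB).
have := nonneg_case mb b0 (ex_intro _ _ bB).
have wE x : w x = v x - b x by rewrite /v addrK.
have -> : \int[mu]_(x in D) (w x * H x) =
    \int[mu]_(x in D) (v x * H x) - \int[mu]_(x in D) (b x * H x).
  rewrite -RintegralB//; [|exact: bounded_integrableM vB _ _|exact: bounded_integrableM bB _ _].
  by apply: eq_Rintegral => x _; rewrite wE mulrBl.
have wI (n : {finite_measure set T -> \bar R}) :
    \int[n]_(x in D) w x = \int[n]_(x in D) v x - \int[n]_(x in D) b x.
  have nD := finite_measure_lty n mD.
  rewrite -RintegralB//; [|exact: bounded_integrable vB nD|exact: bounded_integrable bB nD].
  by apply: eq_Rintegral => x _; rewrite wE.
rewrite !wI; lra.
Qed.

End charge_density.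

(** * Reflections and translations of Lebesgue measure *)

Section reflection.
Variable R : realType.
Local Open Scope ereal_scope.

Lemma measurable_fun_reflection1 (a : R) :
  measurable_fun [set: measurableTypeR R] (fun x => (a - x)%R : measurableTypeR R).
Proof. by apply: measurable_funB. Qed.

Lemma lebesgue_measure_reflection (a : R) (A : set (measurableTypeR R)) : measurable A ->
  lebesgue_measure ((fun x => (a - x)%R) @^-1` A) = lebesgue_measure A.
Proof.
move=> mA.
pose mu := measure_function_pushforward__canonical__measure_function_Measure
  (@lebesgue_measure R) (@measurable_fun_reflection1 a).
apply/esym; apply: (lebesgue_measure_unique (mu := mu)) => // _ [[b c] _ <-].
rewrite /mu /= /pushforward.
have -> : (fun x : R => a - x)%R @^-1` `]b, c] = `[(a - c)%R, (a - b)%R[%classic.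
  by apply/seteqP; split => x /=; rewrite !in_itv/=; lra.
rewrite !lebesgue_measure_itv/= !lte_fin.
have -> : (a - c < a - b)%R = (b < c)%R by apply/idP/idP; lra.
by case: ifP => // _; rewrite -!EFinB; congr EFin; lra.
Qed.

Lemma ge0_integral_reflection1 (a : R) (f : R -> \bar R) :
  measurable_fun [set: measurableTypeR R] f -> (forall x, 0 <= f x) ->
  \int[lebesgue_measure]_x f (a - x)%R = \int[lebesgue_measure]_x f x.
Proof.
move=> mf f0.
transitivity (\int[pushforward (@lebesgue_measure R)
   ((fun x => a - x)%R : measurableTypeR R -> measurableTypeR R)]_x f x).
  by rewrite ge0_integral_pushforward//; exact: measurable_fun_reflection1.
apply: eq_measure_integral => [|? A mA _].
  exact: measurable_fun_reflection1.
exact: lebesgue_measure_reflection.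
Qed.

Lemma measurable_fun_reflection d (a : 'rV[R]_d) :
  measurable_fun [set: 'rV[R]_d] (fun x => (a - x)%R).
Proof.
apply: measurable_fun_mx => i j.
under eq_fun do rewrite !mxE.
by apply: measurable_funB => //; exact: measurable_fun_coord.
Qed.

Lemma measurable_reflection d (a : 'rV[R]_d) (A : set 'rV[R]_d) :
  measurable A -> measurable ((fun x => (a - x)%R) @^-1` A).
Proof.
by move=> mA; rewrite -[X in measurable X]setTI; exact: measurable_fun_reflection.
Qed.

(** Slicing along the first coordinate reduces the claim to the reflection of the
    line and, by induction, to that of the slices. *)
Lemma lebesgue_reflection d (a : 'rV[R]_d) (A : set 'rV[R]_d) :
  measurable A -> lebesgue R d ((fun x => (a - x)%R) @^-1` A) = lebesgue R d A.
Proof.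
elim: d a A => [|d IH] a A mA.
  by congr (lebesgue R 0 _); apply/seteqP; split => x /=; rewrite [(a - x)%R]thinmx0 [x]thinmx0.
have mcons : measurable_fun [set: measurableTypeR R * 'rV[R]_d]
    (fun xy => row_mx (const_mx xy.1) xy.2 : 'rV[R]_(1 + d)).
  apply: measurable_fun_mx => i j.
  case: (split_ordP j) => k ->.
    by under eq_fun do rewrite row_mxEl mxE; exact: measurable_fst.
  under eq_fun do rewrite row_mxEr.
  exact: (measurableT_comp (measurable_fun_coord i k) measurable_snd).
pose sec (B : set 'rV[R]_(1 + d)) (x : R) : set 'rV[R]_d :=
  xsection ((fun xy => row_mx (const_mx xy.1) xy.2) @^-1` B) x.
have mpre (B : set 'rV[R]_(1 + d)) : measurable B ->
    measurable ((fun xy : measurableTypeR R * 'rV[R]_d =>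
      row_mx (const_mx xy.1) xy.2 : 'rV[R]_(1 + d)) @^-1` B).
  by move=> mB; rewrite -[X in measurable X]setTI; exact: mcons.
have lE (B : set 'rV[R]_d.+1) :
    lebesgue R d.+1 B = \int[lebesgue_measure]_x lebesgue R d (sec B x) by [].
rewrite !lE.
pose a0 := (a 0 (@lshift 1 d 0))%R.
rewrite -(@ge0_integral_reflection1 a0 (fun x => lebesgue R d (sec A x)))//; last first.
  by apply: measurable_fun_xsection; exact: mpre.
apply: eq_integral => x _.
rewrite -(IH (@rsubmx R 1 1 d a) (sec A (a0 - x)%R));
  last by apply: measurable_xsection; exact: mpre.
congr (lebesgue R d _).
have consB y : ((a : 'rV[R]_(1 + d)) - row_mx (const_mx x) y =
    row_mx (const_mx (a0 - x)) (@rsubmx R 1 1 d a - y) :> 'rV[R]_(1 + d))%R.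
  rewrite -[in LHS](@hsubmxK R 1 1 d a) (@opp_row_mx R 1 1 d) (@add_row_mx R 1 1 d); congr row_mx.
  by apply/matrixP => i j; rewrite !mxE !ord1.
rewrite /sec /xsection; apply/seteqP; split => y; rewrite /= !inE/=.
  by rewrite -consB.
by move=> Ay; rewrite /preimage/= consB.
Qed.

Lemma ge0_integral_reflection d (a : 'rV[R]_d) (f : 'rV[R]_d -> \bar R) :
  measurable_fun setT f -> (forall x, 0 <= f x) ->
  \int[lebesgue R d]_x f (a - x)%R = \int[lebesgue R d]_x f x.
Proof.
move=> mf f0.
transitivity (\int[pushforward (lebesgue R d) (fun x => a - x)%R]_x f x).
  by rewrite ge0_integral_pushforward//; exact: measurable_fun_reflection.
apply: eq_measure_integral => [|? A mA _].
  exact: measurable_fun_reflection.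
exact: lebesgue_reflection.
Qed.

Lemma integral_reflection d (a : 'rV[R]_d) (f : 'rV[R]_d -> \bar R) :
  measurable_fun setT f ->
  \int[lebesgue R d]_x f (a - x)%R = \int[lebesgue R d]_x f x.
Proof.
move=> mf; rewrite [LHS]integralE [RHS]integralE.
congr (_ - _).
  rewrite -(ge0_integral_reflection a (f := f^\+))//.
    by apply: eq_integral => x _; rewrite ?funeposE ?funenegE.
  exact: measurable_funepos.
rewrite -(ge0_integral_reflection a (f := f^\-))//.
  by apply: eq_integral => x _; rewrite ?funeposE ?funenegE.
exact: measurable_funeneg.
Qed.

End reflection.

Section translation.
Context (R : realType) (d : nat).
Local Notation leb := (lebesgue R d).
Local Open Scope ereal_scope.

Lemma measurable_fun_translation (y : 'rV[R]_d) :
  measurable_fun setT (fun x : 'rV[R]_d => (x - y)%R).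
Proof.
apply: measurable_fun_mx => i j; under eq_fun do rewrite !mxE.
by apply: measurable_funB => //; exact: measurable_fun_coord.
Qed.

(** A translation is the composite of two reflections. *)
Lemma ge0_integral_translation (y : 'rV[R]_d) (f : 'rV[R]_d -> \bar R) :
  measurable_fun setT f -> (forall x, 0 <= f x) ->
  \int[leb]_x f (x - y)%R = \int[leb]_x f x.
Proof.
move=> mf f0.
rewrite -[RHS](ge0_integral_reflection 0)//.
rewrite -[RHS](ge0_integral_reflection y (f := fun x => f (0 - x)%R))//.
  by apply: eq_integral => x _; rewrite sub0r opprB.
exact: (measurableT_comp mf (measurable_fun_reflection 0)).
Qed.

Lemma measurable_fun_subr2 :
  measurable_fun setT (fun xy : 'rV[R]_d * 'rV[R]_d => (xy.1 - xy.2)%R).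
Proof.
apply: measurable_fun_mx => i j.
under eq_fun do rewrite !mxE.
apply: measurable_funB.
  exact: (measurableT_comp (measurable_fun_coord i j) measurable_fst).
exact: (measurableT_comp (measurable_fun_coord i j) measurable_snd).
Qed.

Lemma lebesgue_translation (y : 'rV[R]_d) (A : set 'rV[R]_d) : measurable A ->
  leb ((fun x => (x - y)%R) @^-1` A) = leb A.
Proof.
move=> mA.
rewrite -[RHS](lebesgue_reflection 0)//.
rewrite -[RHS](lebesgue_reflection y); last exact: measurable_reflection.
by congr (leb _); apply/seteqP; split => x /=; rewrite sub0r opprB.
Qed.

End translation.

(** * Boxes and the Euclidean norm *)

Section boxes.
Context (R : realType) (d : nat).
Local Notation leb := (lebesgue R d).

(** Every bounded set lies in one of these cubes, whose measure and compactness
    are those of a product of intervals. *)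
Definition box (r : R) : set 'rV[R]_d := [set x | forall i, `[- r, r]%classic (x 0 i)].

Lemma boxP r x : box r x <-> forall i, `|x 0 i| <= r.
Proof. by split=> bx i; have := bx i; rewrite /= in_itv/= ler_norml. Qed.

Lemma le_box r s : r <= s -> box r `<=` box s.
Proof. by move=> rs x /boxP xr; apply/boxP => i; rewrite (le_trans (xr i)). Qed.

Lemma measurable_box r : measurable (box r).
Proof.
rewrite (_ : box r = \bigcap_(i in [set: 'I_d])
    ((fun x : 'rV[R]_d => x 0 i) @^-1` `[- r, r]%classic)).
  apply: fin_bigcap_measurable => // i _; rewrite -[X in measurable X]setTI.
  exact: measurable_fun_coord.
by apply/seteqP; split => x /= xA i; [move=> _; exact: xA|exact: xA].
Qed.

Lemma lebesgue_measure_box r : 0 < r -> leb (box r) = ((2 * r) ^+ d)%:E.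
Proof.
move=> r0; rewrite (lebesgue_box (A := fun=> `[- r, r]%classic))//.
under eq_bigr do rewrite lebesgue_measure_itv/= lte_fin gtrN// -EFinB opprK.
elim: d => [|n IH]; first by rewrite big_ord0 expr0.
by rewrite big_ord_recl IH -EFinM exprS; congr (_ * _)%:E; lra.
Qed.

Lemma lebesgue_box_lty r : (leb (box r) < +oo)%E.
Proof.
apply: (@le_lt_trans _ _ (leb (box (Num.max r 1)))).
  rewrite le_measure ?inE//; try exact: measurable_box.
  by apply: le_box; rewrite le_max lexx.
by rewrite lebesgue_measure_box ?ltry// lt_max ltr01 orbT.
Qed.

Lemma compact_box r : compact (box r).
Proof.
apply: (@rV_compact R d (fun=> `[- r, r]%classic)) => i.
exact: segment_compact.
Qed.

Lemma bounded_box r : bounded_set (box r).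
Proof. exact/compact_bounded/compact_box. Qed.

Lemma coord_le_norm (x : 'rV[R]_d) i : `|x 0 i| <= `|x|.
Proof. by rewrite [leRHS]mx_normrE; apply: (le_bigmax _ (fun ij => `|x ij.1 ij.2|) (0, i)). Qed.

Lemma mem_box_norm (x : 'rV[R]_d) r : `|x| <= r -> box r x.
Proof. by move=> xr; apply/boxP => i; rewrite (le_trans (coord_le_norm x i)). Qed.

Lemma box_subl (x s : 'rV[R]_d) r : box r (x - s) -> box (`|x| + r) s.
Proof.
move=> /boxP xs; apply/boxP => i.
rewrite (_ : s 0 i = x 0 i - (x - s) 0 i); last by rewrite !mxE; lra.
by rewrite (le_trans (ler_normB _ _))// lerD// coord_le_norm.
Qed.

Lemma bounded_sub_box (A : set 'rV[R]_d) : bounded_set A ->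
  exists r, A `<=` box r.
Proof.
move=> [M [_ AM]]; exists (`|M| + 1) => x Ax; apply: mem_box_norm.
by apply: AM => //; rewrite ltr_pwDr// ler_norm.
Qed.

Lemma coord_le_enorm (x : 'rV[R]_d) i : `|x 0 i| <= enorm x.
Proof.
rewrite /enorm -sqrtr_sqr ler_wsqrtr// (bigD1 i)//= lerDl sumr_ge0// => j _.
exact: sqr_ge0.
Qed.

Lemma enorm_ge0 (x : 'rV[R]_d) : 0 <= enorm x.
Proof. exact: sqrtr_ge0. Qed.

Lemma enorm_le_box (x : 'rV[R]_d) r : 0 <= r -> box r x -> enorm x <= d%:R * r.
Proof.
move=> r0 /boxP xr.
rewrite -[leRHS]ger0_norm ?mulr_ge0// -sqrtr_sqr ler_wsqrtr//.
apply: (@le_trans _ _ (\sum_(i < d) r ^+ 2)).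
  by apply: ler_sum => i _; rewrite -real_normK ?num_real// lerXn2r ?nnegrE.
rewrite sumr_const card_ord exprMn -[leLHS]mulr_natl ler_wpM2r ?sqr_ge0//.
by rewrite -natrX ler_nat; case: (d) => // n; rewrite -mulnn leq_pmulr.
Qed.

Lemma measurable_enorm : measurable_fun setT (@enorm R d).
Proof.
have ms : measurable_fun setT (fun x : 'rV[R]_d => \sum_(i < d) x 0 i ^+ 2).
  by apply: measurable_sum => i; apply: measurable_funX; exact: measurable_fun_coord.
exact: (measurableT_comp (continuous_measurable_fun (@sqrt_continuous R)) ms).
Qed.

Lemma continuous_measurable_mx (f : 'rV[R]_d -> R) :
  continuous f -> measurable_fun setT f.
Proof.
move=> cf; apply: (measurability _ (RGenOpens.measurableE R)).
move=> /= _ [_ [a [b ->] <-]]; rewrite setTI; apply: open_measurable_mx.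
by move/continuousP : cf; apply; exact: interval_open.
Qed.

Lemma continuous_compact_bounded (u : 'rV[R]_d -> R) : continuous u ->
  compact (closure [set x | u x != 0]) ->
  exists B r, (forall x, `|u x| <= B) /\ (forall x, u x != 0 -> box r x).
Proof.
move=> cu cK; set K := closure _ in cK.
have [r Kr] := bounded_sub_box (compact_bounded cK).
have : compact (u @` K).
  by apply: continuous_compact => //; apply: continuous_subspaceT.
move=> /compact_bounded[M [_ uM]].
exists (`|M| + 1), r; split=> x.
  have [->|ux] := eqVneq (u x) 0; first by rewrite normr0 addr_ge0.
  apply: uM; first by rewrite ltr_pwDr// ler_norm.
  by exists x => //; exact: subset_closure.
by move=> ux; apply: Kr; exact: subset_closure.
Qed.

Lemma bounded_support_integrable (u : 'rV[R]_d -> R) (B r : R) :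
  measurable_fun setT u -> (forall x, `|u x| <= B) ->
  (forall x, u x != 0 -> box r x) -> L1 u.
Proof.
move=> meas_u uB ur; rewrite /L1/=.
have mb : measurable (box r) by exact: measurable_box.
have -> : EFin \o u = (EFin \o u) \_ (box r).
  apply/funext => x; rewrite patchE; case: ifPn => //.
  rewrite notin_setE => xr /=; congr EFin; apply: contrapT => /eqP ux.
  by apply: xr; exact: ur.
apply/(integrable_mkcond _ (measurable_box r)).
exact: bounded_integrable (lebesgue_box_lty r).
Qed.

End boxes.

(** * The mass of an algebraically decaying kernel *)

Section decay.
Context (R : realType) (d : nat) (l : R).
Local Notation leb := (lebesgue R d).
Hypothesis dl : d%:R < l.

Definition decay (h : R) (x : 'rV[R]_d) := (1 + enorm x / h) `^ (- l).

Lemma measurable_decay h : measurable_fun setT (decay h).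
Proof.
apply: (measurableT_comp (measurable_powR (- l))).
apply: measurable_funD => //; apply: measurable_funM => //.
exact: measurable_enorm.
Qed.

(** [a k] is [(2 ^ (k - 1)) `^ (- l)], written so as to make sense for [k = 0]. *)
Let a k : R := 2 `^ l * (2 `^ (- l)) ^+ k.

Let a0 k : 0 <= a k.
Proof. by rewrite mulr_ge0 ?exprn_ge0 ?powR_ge0. Qed.

(** Outside the box of half-width [2 ^ (k - 1) * h] the Euclidean norm exceeds
    this half-width, so [decay h] is at most [a k] there; on the smallest box
    it is at most [1 <= a 0]. *)
Let decay_le_dyadic h x : 0 < h ->
  ((decay h x)%:E <= \sum_(k <oo) (a k * \1_(@box R d (2 ^+ k * h)) x)%:E)%E.
Proof.
move=> h0.
have l0 : 0 < l by rewrite (le_lt_trans _ dl).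
have exk : exists k, `[< @box R d (2 ^+ k * h) x >].
  pose k := (Num.truncn (`|x| / h)).+1.
  exists k; apply/asboolP; apply: mem_box_norm.
  rewrite -ler_pdivrMr// (@le_trans _ _ k%:R)//; first exact/ltW/Num.Theory.truncnS_gt.
  by rewrite -natrX ler_nat ltnW// ltn_expl.
case: (ex_minnP exk) => k /asboolP bk kmin.
apply: (@le_trans _ _ (a k * \1_(@box R d (2 ^+ k * h)) x)%:E); last first.
  apply: le_trans (nneseries_lim_ge k.+1 _); last first.
    by move=> i _ _; rewrite lee_fin mulr_ge0.
  rewrite big_nat_recr//= leeDr// sume_ge0// => i _.
  by rewrite lee_fin mulr_ge0.
rewrite indicE mem_set// mulr1 lee_fin /decay /a.
have e0 : 0 <= enorm x / h by rewrite divr_ge0 ?enorm_ge0// ltW.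
case: k bk kmin => [|k] _ kmin.
  rewrite expr0 mulr1 (@le_trans _ _ 1)//.
    rewrite powRN invf_le1 ?powR_gt0 ?ltr_pwDl//.
    by rewrite -[X in X <= _](powRr0 (1 + enorm x / h)) ler_powR ?lerDl// ltW.
  by rewrite -[X in X <= _](powRr0 2) ler_powR ?ler1n// ltW.
have xk : ~ @box R d (2 ^+ k * h) x.
  by move=> /asboolP /kmin; rewrite ltnn.
have ek : 2 ^+ k <= 1 + enorm x / h.
  rewrite (@le_trans _ _ (enorm x / h)) ?lerDr// ler_pdivlMr//.
  rewrite leNgt; apply/negP => ek; apply: xk; apply/boxP => i.
  by rewrite (le_trans (coord_le_enorm x i))// ltW.
rewrite exprS mulrA -powRD ?pnatr_eq0 ?implybT// subrr powRr0 mul1r.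
have -> : (2 `^ (- l)) ^+ k = (2 ^+ k) `^ (- l) :> R.
  by rewrite -powR_mulrn ?powR_ge0// -powR_mulrn// -!powRrM mulrC.
rewrite !powRN lef_pV2 ?posrE ?powR_gt0 ?exprn_gt0 ?ltr_pwDl//.
by rewrite ge0_ler_powR ?nnegrE ?exprn_ge0 ?addr_ge0// ltW.
Qed.

(** The dyadic bound integrates to a geometric series of ratio [2 ^ d / 2 `^ l],
    which converges because [d < l]; the factor [h ^ d] comes from the volumes of
    the boxes. *)
Lemma integral_decay : exists2 c : R, 0 <= c & forall h, 0 < h ->
  (\int[leb]_x (decay h x)%:E <= (c * h ^+ d)%:E)%E.
Proof.
pose q : R := 2 ^+ d * 2 `^ (- l).
have q0 : 0 <= q by rewrite mulr_ge0 ?exprn_ge0 ?powR_ge0.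
have q1 : q < 1.
  rewrite /q -powR_mulrn// -powRD ?pnatr_eq0 ?implybT//.
  rewrite -opprB powRN invf_lt1 ?powR_gt0//.
  have ld : 0 < l - d%:R by rewrite subr_gt0.
  have := @gt0_ltr_powR R _ ld 1 2.
  by rewrite !nnegrE powR1; apply; rewrite ?ltr1n.
pose b : R := 2 `^ l * 2 ^+ d.
have b0 : 0 <= b by rewrite mulr_ge0 ?exprn_ge0 ?powR_ge0.
exists (b / (1 - q)); first by rewrite divr_ge0// subr_ge0 ltW.
move=> h h0.
have mterm k : measurable_fun setT (fun x => (a k * \1_(@box R d (2 ^+ k * h)) x)%:E).
  apply/measurable_EFinP; apply: measurable_funM => //.
  by apply: measurable_indic; exact: measurable_box.
have term0 k x : (0 <= (a k * \1_(@box R d (2 ^+ k * h)) x)%:E)%E.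
  by rewrite lee_fin mulr_ge0.
apply: (@le_trans _ _ (\int[leb]_x (\sum_(k <oo) (a k * \1_(@box R d (2 ^+ k * h)) x)%:E))%E).
  apply: ge0_le_integral => //.
  - by move=> x _; rewrite lee_fin powR_ge0.
  - by apply/measurable_EFinP; exact: measurable_decay.
  - by apply: ge0_emeasurable_sum => // k x _ _; exact: term0.
  - by move=> x _; exact: decay_le_dyadic.
rewrite integral_nneseries//.
apply: lime_le.
  by apply: is_cvg_nneseries => k _ _; apply: integral_ge0 => x _.
apply: nearW => n.
have termE k : (\int[leb]_x (a k * \1_(@box R d (2 ^+ k * h)) x)%:E =
    (b * h ^+ d * q ^+ k)%:E)%E.
  under eq_integral do rewrite EFinM.
  rewrite ge0_integralZl_EFin//; last first.
    by apply/measurable_EFinP; apply: measurable_indic; exact: measurable_box.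
  rewrite integral_indic ?setIT//; last exact: measurable_box.
  transitivity ((a k)%:E * ((2 * (2 ^+ k * h)) ^+ d)%:E)%E.
    by congr (_ * _)%E; apply: lebesgue_measure_box; rewrite mulr_gt0// exprn_gt0.
  rewrite -EFinM; congr EFin.
  rewrite /a /b /q !exprMn [(2 ^+ k) ^+ d]exprAC.
  move: (2 `^ l) ((2 `^ (- l)) ^+ k) (h ^+ d) (2 ^+ d) => z1 z2 z3 z4.
  move: (z4 ^+ k) => z5.
  lra.
under eq_bigr do rewrite termE.
rewrite sumEFin lee_fin.
rewrite -mulr_sumr.
have -> : b / (1 - q) * h ^+ d = b * h ^+ d * (1 - q)^-1 by rewrite mulrAC.
rewrite ler_wpM2l ?mulr_ge0 ?exprn_ge0 ?(ltW h0)//.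
have -> : \sum_(0 <= i < n) q ^+ i = series (geometric 1 q) n.
  by apply: eq_bigr => i _; rewrite /= mul1r.
rewrite geometric_seriesE ?lt_eqF//= mul1r -[leRHS]mul1r ler_wpM2r//.
  by rewrite invr_ge0 subr_ge0 ltW.
by rewrite gerBl exprn_ge0.
Qed.

End decay.

(** * Separated sets *)

Section q_separated.
Context (R : realType) (d : nat).
Implicit Types X : set 'rV[R]_d.

Definition q_separated (q : R) X :=
  forall xi eta, X xi -> X eta -> xi <> eta -> q <= enorm (xi - eta).

Lemma separation_radius_gt0 X : (0 < separation_radius X)%E ->
  exists2 q : R, 0 < q & q_separated q X.
Proof.
rewrite /separation_radius; set I := ereal_inf _ => I0.
have Ipos : (0 < I)%E.
  rewrite ltNge; apply/negP => I0'; move: I0; rewrite ltNge.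
  by rewrite mule_ge0_le0// lee_fin invr_ge0.
have sepI (xi eta : 'rV[R]_d) : X xi -> X eta -> xi <> eta -> (I <= (enorm (xi - eta))%:E)%E.
  by move=> X1 X2 n12; apply: ereal_inf_lbound; exists (xi, eta).
have [Ioo|Ioo] := eqVneq I +oo%E.
  exists 1 => // xi eta X1 X2 n12.
  by have := sepI _ _ X1 X2 n12; rewrite Ioo leye_eq.
have Ifin : I \is a fin_num by rewrite ge0_fin_numE ?ltey// ltW.
exists (fine I); first by rewrite fine_gt0// Ipos ltey.
by move=> xi eta X1 X2 n12; rewrite -lee_fin fineK//; exact: sepI.
Qed.

(** By compactness finitely many small balls cover the box, and each contains at
    most one point of [X]. *)
Lemma finite_separated (q : R) X r : 0 < q -> q_separated q X ->
  finite_set (X `&` box r).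
Proof.
move=> q0 sX.
(* two points of a ball of radius [e] for the sup norm are at Euclidean distance
   at most [2 * d * e < q] *)
pose e := q / (2 * d.+1%:R).
have e0 : 0 < e by rewrite divr_gt0// mulr_gt0.
have := @compact_box R d r; rewrite compact_cover => /(_ _ [set: 'rV[R]_d] (fun x => ball x e)).
case.
- by move=> x _; exact: ball_open.
- by move=> x _; exists x => //; exact: ballxx.
move=> D _; set cs := (Z in cover Z _) => bD.
have fcs : finite_set cs by exact: finite_fset.
have subD : X `&` box r `<=` \bigcup_(x in cs) (X `&` ball x e).
  by move=> xi [Xxi /bD[x Dx xix]]; exists x.
apply: (sub_finite_set subD).
apply: bigcup_finite => // x _.
have [[xi [Xxi bxi]]|nex] := pselect (exists xi, (X `&` ball x e) xi); last first.
  rewrite (_ : _ `&` _ = set0)//; apply/seteqP; split => // xi xiX.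
  by apply: nex; exists xi.
suff sub1 : X `&` ball x e `<=` [set xi] by apply: (sub_finite_set sub1); exact: finite_set1.
move=> eta [Xeta beta] /=; apply: contrapT => ne.
have := sX _ _ Xeta Xxi ne; apply/negP; rewrite -ltNge.
have dx i : `|(eta - xi) 0 i| <= 2 * e.
  case: bxi => _ /(_ 0 i) bxi; case: beta => _ /(_ 0 i) beta.
  rewrite !mxE (_ : _ - _ = (x 0 i - xi 0 i) - (x 0 i - eta 0 i)); last by lra.
  rewrite (le_trans (ler_normB _ _))//.
  by move: bxi beta; rewrite /ball/= => /ltW + /ltW; lra.
have e20 : 0 <= 2 * e by rewrite mulr_ge0// ltW.
have /(enorm_le_box e20) : box (2 * e) (eta - xi) by apply/boxP.
move=> /le_lt_trans; apply.
have eE : 2 * d.+1%:R * e = q by rewrite /e mulrC divfK.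
by rewrite -eE -natr1; move: e0; lra.
Qed.

(** If the fill distance were [0] then [X] would be dense: near a point of [X],
    but not at it, there would be a second one, against the separation. *)
Lemma hfill_gt0 X : (0 < d)%N -> (fill_distance X < +oo)%E ->
  (0 < separation_radius X)%E -> 0 < hfill X.
Proof.
move=> d0 fX /separation_radius_gt0[q q0 sX].
rewrite /hfill fine_gt0// fX andbT ltNge; apply/negP => f0.
have dist x : (ereal_inf [set (enorm (x - xi))%:E | xi in X] <= 0)%E.
  by apply: le_trans f0; apply: ereal_sup_ubound; exists x.
have near x (e : R) : 0 < e -> exists2 xi, X xi & enorm (x - xi) < e.
  move=> e0.
  have : (ereal_inf [set (enorm (x - xi))%:E | xi in X] < e%:E)%E.
    by rewrite (le_lt_trans (dist x))// lte_fin.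
  by move=> /ereal_inf_lt[_ [xi Xxi <-]]; rewrite lte_fin; exists xi.
have [xi Xxi _] := near 0 1 ltr01.
pose i0 := Ordinal d0.
have dR : 0 < d%:R :> R by rewrite ltr0n.
(* [x] is at distance at least [e] from [xi], so a point [eta] of [X] within
   [e / 2] of [x] is not [xi]; yet [eta] is at distance at most
   [d * (3 / 2 * e) = 3 / 4 * q] from it *)
pose e := q / (2 * d%:R).
have e0 : 0 < e by rewrite divr_gt0// mulr_gt0.
pose x := xi + \row_i e.
have [eta Xeta xeta] := near x (e / 2) (divr_gt0 e0 (ltr0Sn R 1)).
have ne : eta <> xi.
  move=> etaE; move: xeta; apply/negP; rewrite -leNgt etaE.
  apply: le_trans (coord_le_enorm _ i0).
  rewrite /x addrAC subrr add0r mxE ger0_norm; last exact: ltW.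
  by rewrite ler_pdivrMr//; lra.
have := sX _ _ Xeta Xxi ne; apply/negP; rewrite -ltNge.
have dx i : `|(eta - xi) 0 i| <= 3 / 2 * e.
  have := le_lt_trans (coord_le_enorm (x - eta) i) xeta.
  rewrite /x !mxE => h.
  rewrite (_ : _ - _ = e - (xi 0 i + e - eta 0 i)); last by lra.
  rewrite (le_trans (ler_normB _ _))// (ger0_norm (ltW e0)).
  by move: h => /ltW h; lra.
have e20 : 0 <= 3 / 2 * e by rewrite mulr_ge0// ltW.
have /(enorm_le_box e20) : box (3 / 2 * e) (eta - xi) by apply/boxP.
move=> /le_lt_trans; apply.
have eE : 2 * d%:R * e = q by rewrite /e mulrC divfK// mulf_neq0// lt0r_neq0.
by rewrite -eE; move: e0 (mulr_gt0 dR e0); lra.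
Qed.

End q_separated.

(** * Convolution inequalities *)

Section young.
Context (R : realType) (d : nat).
Local Notation leb := (lebesgue R d).
Variables (m : {sigma_finite_measure set 'rV[R]_d -> \bar R}) (E : 'rV[R]_d -> R).
Variables (c : R) (u : 'rV[R]_d -> R) (B : R).
Hypotheses (mE : measurable_fun setT E) (E0 : forall y, 0 <= E y).
Hypothesis intE : (\int[m]_y (E y)%:E <= c%:E)%E.
Hypotheses (meas_u : measurable_fun setT u) (uB : forall x, `|u x| <= B).

(** The convolution of [|u|] with the measure of density [E] with respect to [m].
    The weight lets one inequality cover both an integrable kernel, with [m] the
    Lebesgue measure, and a finite measure, with [E = 1]. *)
Definition abs_convolve x := \int[m]_y (`|u (x - y)| * E y).
Local Notation g := abs_convolve.

Let c0 : 0 <= c.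
Proof.
by rewrite -lee_fin (le_trans _ intE)// integral_ge0// => y _; rewrite lee_fin.
Qed.

Lemma measurable_translated (x : 'rV[R]_d) : measurable_fun setT (fun y : 'rV[R]_d => u (x - y)).
Proof. exact: (measurableT_comp meas_u (measurable_fun_reflection x)). Qed.

Lemma integrable_abs_convolve x :
  m.-integrable setT (EFin \o (fun y : 'rV[R]_d => `|u (x - y)| * E y)).
Proof.
have iE : m.-integrable setT (EFin \o E).
  apply/integrableP; split; first exact/measurable_EFinP.
  under eq_integral do rewrite /= ger0_norm//.
  by rewrite (le_lt_trans intE) ?ltry.
apply: (bounded_integrableM measurableT (w := fun y : 'rV[R]_d => `|u (x - y)|) (B := B)) => //.
- by apply: measurableT_comp => //; exact: measurable_translated.
- by move=> y; rewrite normr_id.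
Qed.

Lemma abs_convolveE x : ((g x)%:E = \int[m]_y (`|u (x - y)| * E y)%:E)%E.
Proof.
rewrite /abs_convolve fineK//.
exact: (integrable_fin_num measurableT (integrable_abs_convolve x)).
Qed.

Lemma abs_convolve_ge0 x : 0 <= g x.
Proof. by apply: Rintegral_ge0 => y _; exact: mulr_ge0. Qed.

Let measurable_kernel (h : R -> R) : measurable_fun setT h ->
  measurable_fun setT (fun xy : 'rV[R]_d * 'rV[R]_d => (h (u (xy.1 - xy.2)) * E xy.2)%:E).
Proof.
move=> mh; apply/measurable_EFinP; apply: measurable_funM.
  apply: (measurableT_comp mh); apply: (measurableT_comp meas_u).
  exact: measurable_fun_subr2.
exact: (measurableT_comp mE measurable_snd).
Qed.

Lemma measurable_abs_convolve : measurable_fun setT g.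
Proof.
apply/measurable_EFinP.
rewrite (_ : EFin \o g = fubini_F m
    (fun xy : 'rV[R]_d * 'rV[R]_d => (`|u (xy.1 - xy.2)| * E xy.2)%:E)).
  apply: measurable_fun_fubini_tonelli_F => //.
    exact: (@measurable_kernel (fun t => `|t|)).
  by move=> x; rewrite lee_fin mulr_ge0.
by apply/funext => x; rewrite /= abs_convolveE.
Qed.

(** Hoelder's inequality for the factors [|u| E^(1/r)] and [E^(1/q)] of [|u| E],
    where [q] is the conjugate exponent of [r]. *)
Let powR_abs_convolve_le (r : R) x : 1 <= r ->
  ((g x `^ r)%:E <= (c `^ (r - 1))%:E * \int[m]_y (`|u (x - y)| `^ r * E y)%:E)%E.
Proof.
rewrite le_eqVlt => /predU1P[<-|r1].
  rewrite subrr powRr0 mul1e powRr1 ?abs_convolve_ge0// abs_convolveE.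
  by under [leRHS]eq_integral do rewrite powRr1//.
have r0 : 0 < r by lra.
pose q := r / (r - 1).
have q0 : 0 < q by rewrite divr_gt0//; lra.
have rq : r^-1 + q^-1 = 1.
  by rewrite /q invf_div -[X in X + _]mul1r -mulrDl addrC subrK divff// gt_eqF.
pose f1 (y : 'rV[R]_d) := `|u (x - y)| * E y `^ r^-1.
pose f2 (y : 'rV[R]_d) := E y `^ q^-1.
have mEp s : measurable_fun setT (fun y => E y `^ s).
  exact: (measurableT_comp (measurable_powR s) mE).
have mf1 : measurable_fun setT f1.
  apply: measurable_funM => //.
  by apply: measurableT_comp => //; exact: measurable_translated.
have := hoelder m mf1 (mEp q^-1) r0 q0 rq.
rewrite Lnorm1 -/f2.
have -> : (\int[m]_y `|(EFin \o (f1 \* f2)%R) y| = (g x)%:E)%E.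
  rewrite abs_convolveE; apply: eq_integral => y _ /=.
  rewrite /f1 /f2 -mulrA -powRD ?rq ?oner_eq0// powRr1//.
  by rewrite ger0_norm// mulr_ge0.
rewrite unlock /=.
have -> : (\int[m]_y `|(f1 y)%:E| `^ r = \int[m]_y (`|u (x - y)| `^ r * E y)%:E)%E.
  apply: eq_integral => y _; rewrite /f1 /= ger0_norm ?mulr_ge0 ?powR_ge0//.
  by rewrite powRM ?powR_ge0// -powRrM mulVf ?gt_eqF// powRr1.
have -> : (\int[m]_y `|(f2 y)%:E| `^ q = \int[m]_y (E y)%:E)%E.
  apply: eq_integral => y _; rewrite /f2 /= ger0_norm ?powR_ge0//.
  by rewrite -powRrM mulVf ?gt_eqF// powRr1.
set I := (\int[m]_y (_ * _)%:E)%E; set J := (\int[m]_y _)%E => gle.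
have I0 : (0 <= I)%E by apply: integral_ge0 => y _; rewrite lee_fin mulr_ge0// powR_ge0.
have J0 : (0 <= J)%E by apply: integral_ge0 => y _; rewrite lee_fin.
have pos (z : \bar R) : (0 <= z)%E -> z \in `[0%E, +oo%E] by move=> z0; rewrite in_itv/= z0 leey.
have /(gt0_ler_poweR (ltW r0)) := gle.
rewrite !pos ?mule_ge0 ?poweR_ge0 ?lee_fin ?abs_convolve_ge0// => /(_ isT isT).
rewrite poweR_EFin poweRM ?poweR_ge0// -!poweRrM mulVf ?gt_eqF// poweRe1//.
have -> : q^-1 * r = r - 1 by rewrite /q invf_div divfK// gt_eqF.
move=> /le_trans; apply; rewrite muleC lee_wpmul2r//.
rewrite -poweR_EFin; apply: gt0_ler_poweR => //; rewrite ?pos ?lee_fin//; lra.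
Qed.

Lemma young_real (r : R) : 1 <= r ->
  (Lnorm leb r%:E (EFin \o g) <= c%:E * Lnorm leb r%:E (EFin \o u))%E.
Proof.
move=> r1; have r0 : 0 < r by lra.
rewrite unlock /=.
have -> : (\int[leb]_x `|(EFin \o g) x| `^ r = \int[leb]_x (g x `^ r)%:E)%E.
  by apply: eq_integral => x _; rewrite /= ger0_norm// abs_convolve_ge0.
have mp (h : 'rV[R]_d -> R) : measurable_fun setT h -> measurable_fun setT (fun x => (h x `^ r)%:E).
  by move=> mh; apply/measurable_EFinP; exact: (measurableT_comp (measurable_powR r) mh).
have mnu : measurable_fun setT (fun x => `|u x|) by exact: measurableT_comp.
set I := (\int[leb]_x `|(EFin \o u) x| `^ r)%E.
have I0 : (0 <= I)%E by apply: integral_ge0 => x _; exact: poweR_ge0.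
have mk : measurable_fun setT (fun xy : 'rV[R]_d * 'rV[R]_d =>
    (`|u (xy.1 - xy.2)| `^ r * E xy.2)%:E).
  apply: (@measurable_kernel (fun t => `|t| `^ r)).
  by apply: (measurableT_comp (measurable_powR r)); exact: normr_measurable.
have k0 (xy : 'rV[R]_d * 'rV[R]_d) : (0 <= (`|u (xy.1 - xy.2)| `^ r * E xy.2)%:E)%E.
  by rewrite lee_fin mulr_ge0// powR_ge0.
have mF : measurable_fun setT (fun x : 'rV[R]_d => \int[m]_y (`|u (x - y)| `^ r * E y)%:E)%E.
  exact: (measurable_fun_fubini_tonelli_F _ mk k0).
have main : (\int[leb]_x (g x `^ r)%:E <= (c `^ r)%:E * I)%E.
  apply: (@le_trans _ _ (\int[leb]_x ((c `^ (r - 1))%:E *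
    \int[m]_y (`|u (x - y)| `^ r * E y)%:E))%E).
    apply: ge0_le_integral => //.
    - by move=> x _; rewrite lee_fin powR_ge0.
    - by apply: mp; exact: measurable_abs_convolve.
    - exact: measurable_funeM.
    - by move=> x _; exact: powR_abs_convolve_le.
  rewrite ge0_integralZl//; last 2 first.
  - by move=> x _; apply: integral_ge0 => y _; rewrite lee_fin mulr_ge0// powR_ge0.
  - by rewrite lee_fin powR_ge0.
  have -> : c `^ r = c `^ (r - 1) * c by rewrite mulrC mulr_powRB1.
  rewrite EFinM -muleA lee_wpmul2l ?lee_fin ?powR_ge0//.
  rewrite (fubini_tonelli _ mk k0)/=.
  have -> : (\int[m]_y \int[leb]_x (`|u (x - y)| `^ r * E y)%:E = \int[m]_y (I * (E y)%:E))%E.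
    apply: eq_integral => y _; under eq_integral do rewrite EFinM.
    have mt := measurableT_comp (mp _ mnu) (@measurable_fun_translation R d y).
    rewrite ge0_integralZr ?lee_fin//.
    congr (_ * _)%E.
    apply: (ge0_integral_translation y (mp _ mnu)) => x.
    by rewrite lee_fin powR_ge0.
  rewrite ge0_integralZl//; last 2 first.
  - exact/measurable_EFinP.
  - by move=> y _; rewrite lee_fin.
  by rewrite muleC lee_wpmul2r.
have pos (z : \bar R) : (0 <= z)%E -> z \in `[0%E, +oo%E] by move=> z0; rewrite in_itv/= z0 leey.
have ri0 : 0 <= r^-1 by rewrite invr_ge0 ltW.
have := gt0_ler_poweR ri0 _ _ main.
rewrite !pos; last 2 first.
- by rewrite mule_ge0// lee_fin powR_ge0.
- by apply: integral_ge0 => x _; rewrite lee_fin powR_ge0.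
move=> /(_ isT isT) /le_trans; apply.
rewrite poweRM ?lee_fin ?powR_ge0// poweR_EFin -powRrM mulfV ?gt_eqF//.
by rewrite powRr1.
Qed.

(** For each [y], the [x] at which [|u (x - y)|] exceeds the essential supremum
    of [|u|] form a null set; hence for almost every [x] so do the [y]. *)
Lemma young_infty : (Lnorm leb +oo (EFin \o g) <= c%:E * Lnorm leb +oo (EFin \o u))%E.
Proof.
rewrite unlock /=; case: ifPn => [lebT|_]; last by rewrite mule0.
set s := ess_sup leb (abse \o (EFin \o u)).
have s0 : (0 <= s)%E by apply: ess_sup_gee => //; apply: nearW => x /=; rewrite lee_fin.
have sB : (s <= B%:E)%E by apply/ess_supP; apply: nearW => x /=; rewrite lee_fin.
have sfin : s \is a fin_num by rewrite ge0_fin_numE// (le_lt_trans sB) ?ltry.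
have [N [mN N0 uN]] : {ae leb, forall x, (abse \o (EFin \o u)) x <= s}%E by exact: ess_sup_ge.
pose NN : set ('rV[R]_d * 'rV[R]_d) := (fun xy => xy.1 - xy.2) @^-1` N.
have mNN : measurable NN.
  by rewrite -[X in measurable X]setTI; exact: measurable_fun_subr2.
have NN0 y : leb (ysection NN y) = 0%E.
  rewrite -[RHS]N0 -(lebesgue_translation y mN); congr (leb _).
  by apply/seteqP; split => x; rewrite /ysection/= inE.
apply/ess_supP; have := ae_null_xsection m mNN NN0.
apply: filterS => x xN /=; rewrite ger0_norm ?abs_convolve_ge0// abs_convolveE.
rewrite -(fineK sfin) muleC.
have mmE : measurable_fun setT (fun y => (E y)%:E) by exact/measurable_EFinP.
apply: (@le_trans _ _ (\int[m]_y ((fine s)%:E * (E y)%:E))%E); last first.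
  rewrite ge0_integralZl// ?lee_fin ?fine_ge0//.
    by rewrite lee_wpmul2l// lee_fin fine_ge0.
  by move=> y _; rewrite lee_fin.
apply: ae_ge0_le_integral => //.
- by move=> y _; rewrite lee_fin mulr_ge0.
- by have := integrable_abs_convolve x => /measurable_int.
- by move=> y _; rewrite mule_ge0 ?lee_fin// fine_ge0.
- exact: measurable_funeM.
exists (xsection NN x); split => //; first exact: measurable_xsection.
move=> y /=; apply: contra_notP; rewrite /xsection/= inE => xyN _.
rewrite -EFinM lee_fin ler_wpM2r// -lee_fin fineK//.
by apply: contrapT => su; apply: xyN; apply: uN.
Qed.

Lemma young (p : \bar R) : (1 <= p)%E ->
  (Lnorm leb p (EFin \o g) <= c%:E * Lnorm leb p (EFin \o u))%E.
Proof. by case: p => [r|_|//]; [exact: young_real|exact: young_infty]. Qed.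

End young.

Section charges.
Context (R : realType) (d : nat).
Local Notation leb := (lebesgue R d).
Implicit Types mu nu : {charge set 'rV[R]_d -> \bar R}.

Definition pos_part mu : {finite_measure set 'rV[R]_d -> \bar R} := jordan_pos (hahn mu).
Definition neg_part mu : {finite_measure set 'rV[R]_d -> \bar R} := jordan_neg (hahn mu).

Lemma tv_normE mu : tv_norm mu = (pos_part mu setT + neg_part mu setT)%E.
Proof. by []. Qed.

Lemma charge_parts mu A : measurable A -> mu A = (pos_part mu A - neg_part mu A)%E.
Proof.
move=> mA; rewrite (jordan_decomp (hahn mu) mA) /cadd/= /cscale.
by rewrite EFinN mulN1e.
Qed.

Lemma charge_integralE mu (f : 'rV[R]_d -> \bar R) :
  charge_integral mu f = (\int[pos_part mu]_x f x - \int[neg_part mu]_x f x)%E.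
Proof. by []. Qed.

Lemma compact_measurable (K : set 'rV[R]_d) : compact K -> measurable K.
Proof.
move=> cK; rewrite -[K]setCK; apply: measurableC; apply: open_measurable_mx.
by apply: closed_openC; apply: compact_closed => //; exact: norm_hausdorff.
Qed.

Lemma compactly_supported_box mu : compactly_supported mu ->
  exists r, {ae pos_part mu, forall y, box r y} /\ {ae neg_part mu, forall y, box r y}.
Proof.
move=> [K cK]; rewrite /total_variation /charge_variation => K0.
have [r Kr] := bounded_sub_box (compact_bounded cK).
have mK := compact_measurable cK.
have [p0 n0] : (pos_part mu (~` K) = 0 /\ neg_part mu (~` K) = 0)%E.
  have /eqP := K0; rewrite padde_eq0 ?measure_ge0// => /andP[/eqP ? /eqP ?].
  by split.
exists r; split; exists (~` K); split => //; try exact: measurableC.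
all: by apply: subsetC => x Kx; exact: Kr.
Qed.

End charges.

(** Real-valued, with value [0] where the integral is infinite; for the functions
    convolved below this happens on a null set only. *)
Definition convolve (R : realType) (d : nat) (m : {measure set 'rV[R]_d -> \bar R})
    (f : 'rV[R]_d -> R) (x : 'rV[R]_d) : R := \int[m]_y f (x - y).

Section measurable_convolve.
Context (R : realType) (d : nat).
Variables (m : {sigma_finite_measure set 'rV[R]_d -> \bar R}) (f : 'rV[R]_d -> R).
Hypothesis mf : measurable_fun setT f.

Lemma measurable_econvolve :
  measurable_fun setT (fun s : 'rV[R]_d => \int[m]_y (f (s - y))%:E)%E.
Proof.
pose k (sy : 'rV[R]_d * 'rV[R]_d) := (f (sy.1 - sy.2))%:E.
have mk : measurable_fun setT k.
  apply/measurable_EFinP.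
  exact: (measurableT_comp mf (@measurable_fun_subr2 R d)).
have -> : (fun s : 'rV[R]_d => \int[m]_y (f (s - y))%:E)%E =
    (fubini_F m k^\+ \- fubini_F m k^\-)%E.
  apply/funext => s; rewrite integralE; congr (_ - _)%E.
    by apply: eq_integral => y _; rewrite !funeposE.
  by apply: eq_integral => y _; rewrite !funenegE.
apply: emeasurable_funB.
  apply: measurable_fun_fubini_tonelli_F => //; exact: measurable_funepos.
apply: measurable_fun_fubini_tonelli_F => //; exact: measurable_funeneg.
Qed.

Lemma measurable_convolve : measurable_fun setT (convolve m f).
Proof. exact: (measurableT_comp (@fine_measurable R setT measurableT) measurable_econvolve). Qed.

End measurable_convolve.

Section convolution_fubini.
Context (R : realType) (d : nat).
Local Notation leb := (lebesgue R d).
Variables (m : {finite_measure set 'rV[R]_d -> \bar R}) (rm : R).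
Hypothesis msupp : {ae m, forall y, box rm y}.
Variable Phi : 'rV[R]_d -> R.
Hypothesis lPhi : L1loc Phi.
Variables (u : 'rV[R]_d -> R) (B ru : R).
Hypotheses (meas_u : measurable_fun setT u) (uB : forall x, `|u x| <= B).
Hypothesis usupp : forall x, u x != 0 -> box ru x.

Let mPhi : measurable_fun setT Phi. Proof. by case: lPhi. Qed.

Let mPhi_sub : measurable_fun setT
  (fun sy : 'rV[R]_d * 'rV[R]_d => Phi (sy.1 - sy.2)).
Proof. exact: (measurableT_comp mPhi (@measurable_fun_subr2 R d)). Qed.

Let mu_sub : measurable_fun setT
  (fun sy : 'rV[R]_d * 'rV[R]_d => u (sy.1 - sy.2)).
Proof. exact: (measurableT_comp meas_u (@measurable_fun_subr2 R d)). Qed.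

(** As [m] is carried by a box, [s - y] stays in a bounded set, on which [Phi] is
    integrable, while [s] and [y] vary. *)
Lemma local_kernel_integrable r : (leb \x m)%E.-integrable setT
  (fun sy : 'rV[R]_d * 'rV[R]_d => (\1_(box r) sy.1 * Phi (sy.1 - sy.2))%:E).
Proof.
have mk : measurable_fun setT
    (fun sy : 'rV[R]_d * 'rV[R]_d => (\1_(box r) sy.1 * Phi (sy.1 - sy.2))%:E).
  apply/measurable_EFinP; apply: measurable_funM => //.
  have m1 : measurable_fun setT (\1_(box r) : 'rV[R]_d -> R).
    by apply: measurable_indic; exact: measurable_box.
  exact: (measurableT_comp m1 measurable_fst).
apply/(integrable21ltyP leb m mk) => /=.
have [_ /(_ (box (r + rm)) (@measurable_box R d _) (@bounded_box R d _)) iPhi] := lPhi.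
pose c : \bar R := (\int[leb]_(s in box (r + rm)) `|(Phi s)%:E|)%E.
have c0 : (0 <= c)%E by apply: integral_ge0 => x _; exact: abse_ge0.
have cfin : (c < +oo)%E by case/integrableP : iPhi.
have nk0 (z : 'rV[R]_d * 'rV[R]_d) : (0 <= `|(\1_(box r) z.1 * Phi (z.1 - z.2))%:E|)%E.
  exact: abse_ge0.
have mnk : measurable_fun setT (fun z : 'rV[R]_d * 'rV[R]_d =>
    `|(\1_(box r) z.1 * Phi (z.1 - z.2))%:E|%E) by exact: measurableT_comp.
have m1 : measurable_fun setT (\1_(box r) : 'rV[R]_d -> R).
  by apply: measurable_indic; exact: measurable_box.
have mrestr : measurable_fun setT ((fun s => `|(Phi s)%:E|%E) \_ (box (r + rm))).
  apply/(measurable_restrictT _ _).1; first exact: measurable_box.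
  by apply: measurableT_comp => //; apply/measurable_EFinP; exact: measurable_funTS.
apply: (@le_lt_trans _ _ (\int[m]_y c)%E); last first.
  rewrite integral_cst// lte_mul_pinfty//; first by rewrite ge0_fin_numE.
  by rewrite -ge0_fin_numE//; exact: fin_num_measure.
apply: ae_ge0_le_integral => //.
- by move=> y _; apply: integral_ge0 => x _; rewrite lee_fin.
- exact: (measurable_fun_fubini_tonelli_G _ mnk nk0).
apply: filterS msupp => y /boxP yrm _.
rewrite /c [leRHS]integral_mkcond.
rewrite -[leRHS](ge0_integral_translation y)//; last first.
  by move=> x; rewrite patchE; case: ifP => // _; exact: abse_ge0.
apply: ge0_le_integral => //.
- apply/measurable_EFinP; apply: measurableT_comp => //; apply: measurable_funM => //.
  exact: (measurableT_comp mPhi (@measurable_fun_translation R d y)).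
- exact: (measurableT_comp mrestr (@measurable_fun_translation R d y)).
move=> s _; rewrite patchE /= indicE.
have [/set_mem/boxP sr|_] := boolP (s \in box r).
  rewrite mem_set ?mul1r//; apply/boxP => i; rewrite !mxE.
  by rewrite (le_trans (ler_normB _ _))// lerD.
by rewrite mul0r normr0; case: ifP => // _; rewrite lee_fin.
Qed.

Lemma ae_section_integrable r :
  {ae leb, forall s, box r s -> m.-integrable setT (fun y => (Phi (s - y))%:E)}.
Proof.
have := ae_integrable1 (local_kernel_integrable r).
apply: filterS => s /= + sr; apply: eq_integrable => // y _.
by rewrite indicE mem_set// mul1r.
Qed.

Lemma integrable_convolve r : leb.-integrable (box r) (EFin \o convolve m Phi).
Proof.
have iF := integrable_fubini_F (local_kernel_integrable r).
pose F (s : 'rV[R]_d) : \bar R := (\int[m]_y (\1_(box r) s * Phi (s - y))%:E)%E.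
have {}iF : leb.-integrable setT F by exact: iF.
have {}iF : leb.-integrable (box r) F.
  by apply: integrableS iF => //; exact: measurable_box.
have FE s : box r s -> convolve m Phi s = fine (F s).
  move=> rs; rewrite /convolve /Rintegral /F; congr fine; apply: eq_integral => y _.
  by rewrite indicE mem_set// mul1r.
apply: (le_integrable (@measurable_box R d r) _ _ iF).
- apply: (eq_measurable_fun (EFin \o (fine \o F))).
    by move=> s /set_mem rs; rewrite /= FE.
  apply/measurable_EFinP; apply: measurableT_comp => //.
  exact: measurable_int iF.
- move=> s rs; rewrite /= FE//; case: (F s) => [z| |] //=; by rewrite normr0 leey.
Qed.

Lemma integrable_translated t : m.-integrable setT (EFin \o (fun y : 'rV[R]_d => u (t - y))).
Proof.
apply: (bounded_integrable measurableT (w := fun y : 'rV[R]_d => u (t - y)) (B := B)) => //.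
  exact: (measurableT_comp meas_u (measurable_fun_reflection t)).
exact: finite_measure_lty.
Qed.

Let f1 x (sy : 'rV[R]_d * 'rV[R]_d) : \bar R := (u (x - sy.1) * Phi (sy.1 - sy.2))%:E.
Let f2 x (ty : 'rV[R]_d * 'rV[R]_d) : \bar R := (u (ty.1 - ty.2) * Phi (x - ty.1))%:E.

Let mf1 x : measurable_fun setT (f1 x).
Proof.
apply/measurable_EFinP; apply: measurable_funM => //.
exact: (measurableT_comp (measurableT_comp meas_u (measurable_fun_reflection x)) measurable_fst).
Qed.

Let mf2 x : measurable_fun setT (f2 x).
Proof.
apply/measurable_EFinP; apply: measurable_funM => //.
exact: (measurableT_comp (measurableT_comp mPhi (measurable_fun_reflection x)) measurable_fst).
Qed.

Let f12 x s y : f1 x (x + y - s, y) = f2 x (s, y).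
Proof.
rewrite /f1 /f2 /=; congr (u _ * Phi _)%:E; last by rewrite addrAC addrK.
by rewrite opprB addrCA opprD [x + _]addrA subrr add0r.
Qed.

Let f1_section x y : measurable_fun setT (fun s => f1 x (s, y)).
Proof.
apply/measurable_EFinP; apply: measurable_funM => //=.
  exact: (measurableT_comp meas_u (measurable_fun_reflection x)).
exact: (measurableT_comp mPhi (@measurable_fun_translation R d y)).
Qed.

Let f1_integrable x : (leb \x m)%E.-integrable setT (f1 x).
Proof.
pose r := `|x| + ru.
have iB := integrableZl measurableT B (local_kernel_integrable r).
apply: le_integrable iB => //.
move=> [s y] _; rewrite /f1 /= lee_fin !normrM indicE.
have [->|/usupp/box_subl us] := eqVneq (u (x - s)) 0; first by rewrite normr0 mul0r !mulr_ge0.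
by rewrite mem_set//= normr1 mul1r ler_wpM2r// (le_trans (uB _))// ler_norm.
Qed.

Let f2_integrable x : (leb \x m)%E.-integrable setT (f2 x).
Proof.
apply/(integrable21ltyP leb m (mf2 x)).
have := (integrable21ltyP leb m (mf1 x)).1 (f1_integrable x).
apply: le_lt_trans; rewrite le_eqVlt; apply/orP; left; apply/eqP.
apply: eq_integral => y _.
rewrite -[RHS](ge0_integral_reflection (x + y)); last 2 first.
- by apply: measurableT_comp => //; exact: f1_section.
- by move=> s; exact: abse_ge0.
by apply: eq_integral => s _; rewrite f12.
Qed.

Lemma integrable_convolveM x :
  leb.-integrable setT (EFin \o (fun t => convolve m u t * Phi (x - t))).
Proof.
have := integrable_fubini_F (f2_integrable x).
apply: eq_integrable => // t _; rewrite /fubini_F /f2 /= EFinM.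
under eq_integral do rewrite EFinM.
rewrite integralZr//; last exact: integrable_translated.
congr (_ * _)%E; rewrite /convolve /Rintegral fineK//.
exact: (integrable_fin_num measurableT (integrable_translated t)).
Qed.

(** This is [u * (Phi * m) = (u * m) * Phi] at [x]: Fubini's theorem is applied on
    both sides of the substitution [s = x + y - t]. *)
Lemma Rintegral_convolveM x :
  \int[leb]_s (u (x - s) * convolve m Phi s) = \int[leb]_t (convolve m u t * Phi (x - t)).
Proof.
rewrite /Rintegral; congr fine.
transitivity (\int[leb]_s \int[m]_y f1 x (s, y))%E.
  apply: ae_eq_integral => //.
  - apply/measurable_EFinP; apply: measurable_funM.
      exact: (measurableT_comp meas_u (measurable_fun_reflection x)).
    exact: measurable_convolve.
  - exact: (measurable_int _ (integrable_fubini_F (f1_integrable x))).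
  pose r := `|x| + ru.
  apply: filterS (ae_section_integrable r) => s sint _.
  have [u0|us] := eqVneq (u (x - s)) 0.
    rewrite u0 mul0r integral0_eq// => y _.
    by rewrite /f1 /= u0 mul0r.
  have {}sint : m.-integrable setT (EFin \o (fun y : 'rV[R]_d => Phi (s - y))).
    exact/sint/box_subl/usupp.
  rewrite EFinM /convolve /Rintegral fineK; last exact: integrable_fin_num.
  by rewrite -integralZl//; apply: eq_integral => y _; rewrite /f1 EFinM.
transitivity (\int[leb]_t \int[m]_y f2 x (t, y))%E.
  rewrite (Fubini (f1_integrable x)) (Fubini (f2_integrable x)).
  apply: eq_integral => y _.
  rewrite -(integral_reflection (x + y)); last exact: f1_section.
  by apply: eq_integral => s _; rewrite f12.
apply: eq_integral => t _; rewrite /f2 /= EFinM.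
under eq_integral do rewrite EFinM.
rewrite integralZr//; last exact: integrable_translated.
congr (_ * _)%E; rewrite /convolve /Rintegral fineK//.
exact: (integrable_fin_num measurableT (integrable_translated t)).
Qed.

End convolution_fubini.

Section charge_young.
Context (R : realType) (d : nat).
Local Notation leb := (lebesgue R d).
Variables (mu : {charge set 'rV[R]_d -> \bar R}) (u : 'rV[R]_d -> R) (B : R).
Hypotheses (meas_u : measurable_fun setT u) (uB : forall x, `|u x| <= B).
Local Notation L p g := (Lnorm leb p (EFin \o g)).

(** The convolution of [|u|] with the total variation of [mu]. *)
Definition charge_abs_convolve x :=
  abs_convolve (pos_part mu) (fun=> 1) u x + abs_convolve (neg_part mu) (fun=> 1) u x.

Let m1 : measurable_fun [set: 'rV[R]_d] (fun=> 1 : R).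
Proof. exact: measurable_cst. Qed.

Let int1 (m : {finite_measure set 'rV[R]_d -> \bar R}) :
  (\int[m]_y 1%:E <= (fine (m setT))%:E)%E.
Proof. by rewrite integral_cst// mul1e fineK//; exact: fin_num_measure. Qed.

Lemma measurable_charge_abs_convolve : measurable_fun setT charge_abs_convolve.
Proof.
apply: measurable_funD.
  exact: (measurable_abs_convolve m1 (fun=> ler01) (int1 (pos_part mu)) meas_u uB).
exact: (measurable_abs_convolve m1 (fun=> ler01) (int1 (neg_part mu)) meas_u uB).
Qed.

Lemma charge_young p : (1 <= p)%E ->
  (L p charge_abs_convolve <= tv_norm mu * L p u)%E.
Proof.
move=> p1.
have mp := measurable_abs_convolve m1 (fun=> ler01) (int1 (pos_part mu)) meas_u uB.
have mn := measurable_abs_convolve m1 (fun=> ler01) (int1 (neg_part mu)) meas_u uB.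
apply: (le_trans (eminkowski _ mp mn p1)).
rewrite tv_normE ge0_muleDl// leeD//.
  have := young m1 (fun=> ler01) (int1 (pos_part mu)) meas_u uB p1.
  by rewrite fineK//; exact: fin_num_measure.
have := young m1 (fun=> ler01) (int1 (neg_part mu)) meas_u uB p1.
by rewrite fineK//; exact: fin_num_measure.
Qed.

Lemma norm_charge_convolve_le x :
  `|\int[pos_part mu]_s u (x - s) - \int[neg_part mu]_s u (x - s)| <= charge_abs_convolve x.
Proof.
rewrite (le_trans (ler_normB _ _))// lerD//.
all: rewrite (le_trans (le_normr_Rintegral _ (integrable_translated _ meas_u uB x)))//.
all: by rewrite /abs_convolve; under [leRHS]eq_Rintegral do rewrite mulr1.
Qed.

Lemma charge_abs_convolve_le x : charge_abs_convolve x <= B * fine (tv_norm mu).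
Proof.
have avg (m : {finite_measure set 'rV[R]_d -> \bar R}) :
    abs_convolve m (fun=> 1) u x <= B * fine (m setT).
  rewrite -(Rintegral_cst m measurableT B).
  apply: le_Rintegral => //.
  - exact: (integrable_abs_convolve m1 (fun=> ler01) (int1 m) meas_u uB x).
  - exact: finite_measure_integrable_cst.
  - by move=> y _; rewrite mulr1.
by rewrite tv_normE fineD ?fin_num_measure// mulrDr lerD.
Qed.

End charge_young.

Lemma convolve_support (R : realType) (d : nat)
    (m : {finite_measure set 'rV[R]_d -> \bar R}) (rm ru : R) (u : 'rV[R]_d -> R) t :
  {ae m, forall y, box rm y} -> measurable_fun setT u ->
  (forall x, u x != 0 -> box ru x) ->
  convolve m u t != 0 -> box (ru + rm) t.
Proof.
move=> mrm meas_u ur; apply: contra_neqP => tbox.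
rewrite /convolve /Rintegral (ae_eq_integral (cst 0%E))//.
- by rewrite integral_cst// mul0e.
- by apply/measurable_EFinP; exact: (measurableT_comp meas_u (measurable_fun_reflection t)).
apply: filterS mrm => y /boxP yrm _ /=; congr EFin; apply/eqP.
apply: contra_notT tbox => /ur /boxP ty; apply/boxP => i.
rewrite (_ : t 0 i = (t - y) 0 i + y 0 i); last by rewrite !mxE; lra.
by rewrite (le_trans (ler_normD _ _))// lerD.
Qed.

(** * Splitting the reproduction formula *)

Section decomposition.
Context (R : realType) (d : nat).
Local Notation leb := (lebesgue R d).
Variables (mu nu : {charge set 'rV[R]_d -> \bar R}) (rm : R).
Local Notation mup := (pos_part mu).
Local Notation mun := (neg_part mu).
Local Notation nup := (pos_part nu).
Local Notation nun := (neg_part nu).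
Hypothesis mup_supp : {ae mup, forall y, box rm y}.
Hypothesis mun_supp : {ae mun, forall y, box rm y}.
Variables (G Phi : 'rV[R]_d -> R).
Hypothesis lG : L1loc G.
Hypothesis lPhi : L1loc Phi.
Hypothesis GE : eq_convolution_plus G Phi mu nu.
Variables (u : 'rV[R]_d -> R) (B ru : R).
Hypotheses (meas_u : measurable_fun setT u) (uB : forall x, `|u x| <= B).
Hypothesis usupp : forall x, u x != 0 -> box ru x.

Let H s := G s - (convolve mup Phi s - convolve mun Phi s).

Let mH : measurable_fun setT H.
Proof.
apply: measurable_funB; first by case: lG.
by apply: measurable_funB; apply: measurable_convolve; case: lPhi.
Qed.

Let iP r : leb.-integrable (box r)
  (EFin \o (fun s => convolve mup Phi s - convolve mun Phi s)).
Proof.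
have mb := @measurable_box R d r.
have := integrableB mb (integrable_convolve mup_supp lPhi r) (integrable_convolve mun_supp lPhi r).
by apply: eq_integrable.
Qed.

Let iG r : leb.-integrable (box r) (EFin \o G).
Proof. by case: lG => _ ; apply; [exact: measurable_box|exact: bounded_box]. Qed.

Let iH r : leb.-integrable (box r) (EFin \o H).
Proof.
have mb := @measurable_box R d r.
by have := integrableB mb (iG r) (iP r); apply: eq_integrable.
Qed.

Let HE r A : measurable A -> A `<=` box r ->
  (\int[leb]_(x in A) (H x)%:E = nup A - nun A)%E.
Proof.
move=> mA Ar.
have bA : bounded_set A.
  have [M [Mreal bM]] := @bounded_box R d r.
  by exists M; split => // z Mz y Ay; apply: bM => //; exact: Ar.
have mb := @measurable_box R d r.
have iGA := integrableS mb mA Ar (iG r).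
have iPA := integrableS mb mA Ar (iP r).
under eq_integral do rewrite EFinB.
rewrite integralB//.
have := GE mA bA; rewrite (charge_parts nu mA).
have -> : (\int[leb]_(x in A) convolution Phi mu x =
    \int[leb]_(x in A) (convolve mup Phi x - convolve mun Phi x)%:E)%E.
  apply: ae_eq_integral => //.
  - by apply: measurable_funTS; apply: emeasurable_funB; apply: measurable_econvolve; case: lPhi.
  - by have := measurable_int _ iPA.
  have := ae_section_integrable mup_supp lPhi r.
  have := ae_section_integrable mun_supp lPhi r.
  apply: filterS2 => s sn sp As.
  rewrite /convolution charge_integralE EFinB /convolve /Rintegral !fineK//.
    by apply: integrable_fin_num => //; exact/sn/Ar.
  by apply: integrable_fin_num => //; exact/sp/Ar.
have := integrable_fin_num mA iPA => /=; set p := (\int[leb]_(x in A) _)%E => pfin ->.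
by rewrite addeAC subee// add0e.
Qed.

(** In short, [u * G = (u * mu) * Phi + u * nu]. The function [H = G - Phi * mu]
    has the values of [nu] as its integrals over bounded sets, which turns
    [u * H] into [u * nu]; in [u * (Phi * mu)] the measure is moved onto [u]. *)
Lemma reproduction_split x :
  \int[leb]_t (u t * G (x - t)) =
  \int[leb]_t ((convolve mup u t - convolve mun u t) * Phi (x - t)) +
  (\int[nup]_s u (x - s) - \int[nun]_s u (x - s)).
Proof.
pose r := `|x| + ru; have mb := @measurable_box R d r.
have supp s : u (x - s) != 0 -> box r s by move=> /usupp/box_subl.
have mw : measurable_fun setT (fun s : 'rV[R]_d => u (x - s)).
  exact: (measurableT_comp meas_u (measurable_fun_reflection x)).
have toD (n : {measure set 'rV[R]_d -> \bar R}) (h : 'rV[R]_d -> R) :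
    \int[n]_s (u (x - s) * h s) = \int[n]_(s in box r) (u (x - s) * h s).
  rewrite [RHS]Rintegral_mkcond; apply: eq_Rintegral => s _.
  rewrite patchE; case: ifPn => //; rewrite notin_setE => sr.
  have [->|/supp//] := eqVneq (u (x - s)) 0; by rewrite mul0r.
have toD1 (n : {measure set 'rV[R]_d -> \bar R}) :
    \int[n]_s u (x - s) = \int[n]_(s in box r) u (x - s).
  have := toD n (fun=> 1).
  by under eq_Rintegral do rewrite mulr1; under [in RHS]eq_Rintegral do rewrite mulr1.
have bM (h : 'rV[R]_d -> R) : leb.-integrable (box r) (EFin \o h) ->
    leb.-integrable (box r) (EFin \o (fun s => u (x - s) * h s)).
  by apply: (bounded_integrableM mb mw (B := B)).
rewrite !toD1.
rewrite -(Rintegral_charge_density mb mH (iH r) (@HE r) mw (fun s => uB (x - s))).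
have -> : \int[leb]_t ((convolve mup u t - convolve mun u t) * Phi (x - t)) =
    \int[leb]_(s in box r) (u (x - s) * (convolve mup Phi s - convolve mun Phi s)).
  under eq_Rintegral do rewrite mulrBl.
  rewrite RintegralB//; [|exact: (integrable_convolveM mup_supp lPhi meas_u uB usupp)
                         |exact: (integrable_convolveM mun_supp lPhi meas_u uB usupp)].
  rewrite -(Rintegral_convolveM mup_supp lPhi meas_u uB usupp).
  rewrite -(Rintegral_convolveM mun_supp lPhi meas_u uB usupp).
  rewrite !toD -RintegralB//;
    [|exact: (bM _ (integrable_convolve mup_supp lPhi r))
     |exact: (bM _ (integrable_convolve mun_supp lPhi r))].
  by apply: eq_Rintegral => s _; rewrite mulrBr.
have -> : \int[leb]_t (u t * G (x - t)) = \int[leb]_s (u (x - s) * G s).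
  rewrite /Rintegral -(integral_reflection x); last first.
    apply/measurable_EFinP; apply: measurable_funM => //.
    by case: lG => mG _; exact: (measurableT_comp mG (measurable_fun_reflection x)).
  by congr fine; apply: eq_integral => s _; rewrite subKr.
rewrite toD -RintegralD//; [|exact: (bM _ (iP r))|exact: (bM _ (iH r))].
by apply: eq_Rintegral => s _; rewrite /H; lra.
Qed.

End decomposition.

(** * A measurable choice of coefficients *)

Section selection.
Context d1 d2 (T1 : measurableType d1) (T2 : measurableType d2) (R : realType).
Variables (m1 : {sigma_finite_measure set T1 -> \bar R}).
Variables (m2 : {sigma_finite_measure set T2 -> \bar R}).
Variables (N : nat) (Psi E : T1 * T2 -> R) (phi : 'I_N -> T1 -> R).
Variables (a : 'I_N -> T2 -> R) (D : set T2).
Hypotheses (mPsi : measurable_fun setT Psi) (mE : measurable_fun setT E).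
Hypotheses (mphi : forall i, measurable_fun setT (phi i)).
Hypotheses (ma : forall i, measurable_fun setT (a i)).
Hypothesis cover : forall t, D t -> exists Z : {set 'I_N}, forall x,
  `|Psi (x, t) - \sum_(i in Z) a i t * phi i x| <= E (x, t).

Let excess (Z : {set 'I_N}) (z : T1 * T2) :=
  `|Psi z - \sum_(i in Z) a i z.2 * phi i z.1| - E z.

Let mexcess Z : measurable_fun setT (excess Z).
Proof.
apply: measurable_funB => //; apply: measurableT_comp => //.
apply: measurable_funB => //.
under eq_fun do rewrite big_mkcond /=.
apply: measurable_sum => i; case: (i \in Z) => //; apply: measurable_funM.
  exact: (measurableT_comp (ma i) measurable_snd).
exact: (measurableT_comp (mphi i) measurable_fst).
Qed.

Let bad Z : set (T1 * T2) := excess Z @^-1` `]0, +oo[.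

Let mbad Z : measurable (bad Z).
Proof. by rewrite -[X in measurable X]setTI; exact: mexcess. Qed.

(** The [t] at which the estimate with the indices [Z] holds for almost every
    [x]. The set of [t] at which it holds for every [x] need not be
    measurable. *)
Let good Z : set T2 := (m1 \o ysection (bad Z)) @^-1` [set 0%E].

Let mgood Z : measurable (good Z).
Proof.
rewrite -[X in measurable X]setTI.
by apply: (measurable_fun_ysection m1 (mbad Z)).
Qed.

Let count_good t : R := \sum_(Z : {set 'I_N}) \1_(good Z) t.

Let mcount : measurable_fun setT count_good.
Proof.
by apply: measurable_sum => Z; apply: measurable_indic; exact: mgood.
Qed.

(** Equal weights for the [Z] that are good at [t]; the inverse is written as a
    power to keep it visibly measurable. *)
Let weight Z t : R := \1_(good Z) t * count_good t `^ (- 1).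

Let mweight Z : measurable_fun setT (weight Z).
Proof.
apply: measurable_funM; first by apply: measurable_indic; exact: mgood.
exact: (measurableT_comp (measurable_powR (- 1)) mcount).
Qed.

Let weight_ge0 Z t : 0 <= weight Z t.
Proof. by rewrite mulr_ge0 ?powR_ge0. Qed.

Let sum_weight t : \sum_Z weight Z t <= 1.
Proof.
rewrite -mulr_suml -/(count_good t).
have c0 : 0 <= count_good t by apply: sumr_ge0.
rewrite powR_inv1//; have [->|c1] := eqVneq (count_good t) 0.
  by rewrite mul0r.
by rewrite divff.
Qed.

Let sum_weight1 t : D t -> \sum_Z weight Z t = 1.
Proof.
move=> Dt; rewrite -mulr_suml -/(count_good t).
have [Z hZ] := cover Dt.
have gZ : good Z t.
  rewrite /good /= (_ : ysection _ _ = set0) ?measure0//.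
  apply/seteqP; split => // x; rewrite /ysection/= inE /bad/= in_itv/= andbT.
  by rewrite subr_gt0 ltNge hZ.
have c1 : 1 <= count_good t.
  rewrite /count_good (bigD1 Z)//= indicE mem_set// lerDl.
  by apply: sumr_ge0.
by rewrite powR_inv1 ?(le_trans _ c1)// divff// gt_eqF// (lt_le_trans _ c1).
Qed.

(** The estimate being convex in the coefficients, it holds for the average of
    [a i t], taken as [0] for [i] outside [Z], over the sets [Z] good at [t]. *)
Lemma measurable_selection : exists rho : 'I_N -> T2 -> R,
  [/\ forall i, measurable_fun setT (rho i), forall i t, 0 <= rho i t <= 1 &
    {ae m1, forall x, {ae m2, forall t, D t ->
      `|Psi (x, t) - \sum_(i < N) rho i t * a i t * phi i x| <= E (x, t)}}].
Proof.
exists (fun i t => \sum_(Z : {set 'I_N} | i \in Z) weight Z t); split.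
- by move=> i; under eq_fun do rewrite big_mkcond/=; apply: measurable_sum => Z; case: (i \in Z).
- move=> i t; rewrite sumr_ge0//= (le_trans _ (sum_weight t))//.
  rewrite [leRHS](bigID (fun Z : {set 'I_N} => i \in Z))/= lerDl.
  by apply: sumr_ge0.
pose bb Z : set (T1 * T2) := bad Z `&` (snd @^-1` good Z).
have mbb Z : measurable (bb Z).
  apply: measurableI => //.
  by rewrite -[X in measurable X]setTI; exact: measurable_snd.
pose NN : set (T1 * T2) := \bigcup_(Z in [set: {set 'I_N}]) bb Z.
have mNN : measurable NN by apply: fin_bigcup_measurable => // Z _; exact: mbb.
have NN0 t : m1 (ysection NN t) = 0%E.
  have bb0 Z : m1 (ysection (bb Z) t) = 0%E.
    have [gZ|ngZ] := pselect (good Z t).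
      rewrite -[RHS]gZ /=; congr (m1 _); apply/seteqP; split => x; rewrite /ysection/= !inE//.
      by case.
    rewrite (_ : ysection _ _ = set0) ?measure0//.
    by apply/seteqP; split => // x; rewrite /ysection/= inE => -[_ /ngZ].
  apply/negligibleP; first exact: measurable_ysection.
  have : {ae m1, forall x, forall Z, ~ ysection (bb Z) t x}.
    apply: filter_forall => Z; exists (ysection (bb Z) t); split => //.
      exact: measurable_ysection.
    by move=> x /=; apply: contra_notP.
  apply: negligibleS => x; rewrite /ysection/= inE => -[Z _ bZ] /(_ Z).
  by rewrite inE.
have := ae_null_xsection m2 mNN NN0.
apply: filterS => x xNN.
exists (xsection NN x); split => //; first exact: measurable_xsection.
move=> t /= /not_implyP[Dt].
rewrite /xsection/= inE; apply: contra_notP => xt.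
have -> : Psi (x, t) - \sum_(i < N) (\sum_(Z : {set 'I_N} | i \in Z) weight Z t) * a i t * phi i x =
    \sum_Z weight Z t * (Psi (x, t) - \sum_(i in Z) a i t * phi i x).
  under [RHS]eq_bigr do rewrite mulrBr.
  rewrite sumrB -mulr_suml (sum_weight1 Dt) mul1r; congr (_ - _).
  under [LHS]eq_bigr do rewrite -mulrA mulr_suml.
  under [RHS]eq_bigr do rewrite mulr_sumr.
  by rewrite (exchange_big_dep xpredT)//.
rewrite (le_trans (ler_norm_sum _ _ _))//.
rewrite -[leRHS]mul1r -(sum_weight1 Dt) mulr_suml; apply: ler_sum => Z _.
rewrite normrM ger0_norm// /weight indicE.
have [/set_mem gZ|_] := boolP (t \in good Z); last by rewrite !mul0r.
rewrite ler_wpM2l ?mulr_ge0 ?powR_ge0// leNgt; apply/negP => lt.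
apply: xt; exists Z => //; split => //.
by rewrite /bad /= in_itv/= andbT subr_gt0.
Qed.

End selection.

(** * Quasi-interpolation *)

Section quasi_interpolation.
Context (R : realType) (d : nat).
Local Notation leb := (lebesgue R d).
Variables (X : set 'rV[R]_d) (q : R) (Phi : 'rV[R]_d -> R) (C0 l kappa CE cd : R).
Local Notation h := (hfill X).
Hypotheses (q0 : 0 < q) (sX : q_separated q X) (h0 : 0 < h).
Hypotheses (mPhi : measurable_fun setT Phi) (CE0 : 0 < CE).
Hypothesis p2 : property2 C0 l kappa CE X Phi.
Hypothesis intdecay : (\int[leb]_x (decay l h x)%:E <= (cd * h ^+ d)%:E)%E.
Variables (w : 'rV[R]_d -> R) (Bw rw : R).
Hypotheses (mw : measurable_fun setT w) (wB : forall t, `|w t| <= Bw).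
Hypothesis wsupp : forall t, w t != 0 -> box rw t.
Hypothesis iw : forall x, leb.-integrable setT (EFin \o (fun t => w t * Phi (x - t))).

Definition error_kernel (y : 'rV[R]_d) := CE * h `^ (kappa - d%:R) * decay l h y.
Local Notation Eh := error_kernel.

Lemma measurable_error_kernel : measurable_fun setT Eh.
Proof. by apply: measurable_funM => //; exact: measurable_decay. Qed.

Lemma error_kernel_ge0 y : 0 <= Eh y.
Proof. by rewrite mulr_ge0 ?powR_ge0// mulr_ge0 ?powR_ge0// ltW. Qed.

Lemma integral_error_kernel : (\int[leb]_y (Eh y)%:E <= (CE * cd * h `^ kappa)%:E)%E.
Proof.
under eq_integral do rewrite EFinM.
rewrite ge0_integralZl//; last 3 first.
- by apply/measurable_EFinP; exact: measurable_decay.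
- by move=> y _; rewrite lee_fin powR_ge0.
- by rewrite lee_fin mulr_ge0 ?powR_ge0// ltW.
apply: (@le_trans _ _ ((CE * h `^ (kappa - d%:R))%:E * (cd * h ^+ d)%:E)%E).
  by rewrite lee_wpmul2l// lee_fin mulr_ge0 ?powR_ge0// ltW.
rewrite -EFinM lee_fin -powR_mulrn ?(ltW h0)//.
have -> : h `^ kappa = h `^ (kappa - d%:R) * h `^ d%:R.
  by rewrite -powRD ?subrK// (gt_eqF h0) implybT.
lra.
Qed.

(** The coefficient of [Phi (x - xi)] is the integral of [w t * A t xi], reduced by
    the factor in [[0, 1]] that the measurable selection provides. *)
Lemma quasi_interpolation : exists (Y : set 'rV[R]_d) (a : 'rV[R]_d -> R),
  [/\ finite_set Y, Y `<=` X &
    {ae leb, forall x,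
      `|\int[leb]_t (w t * Phi (x - t)) - \sum_(xi \in Y) a xi * Phi (x - xi)|
        <= abs_convolve leb Eh w x}].
Proof.
have [Xt [A [XtX A1 bound]]] := p2.
(* [Y0] contains [Xt t] for every [t] in the support of [w] *)
pose Y0 := X `&` box (rw + C0 * h).
have /finite_seqP[s0 s0E] : finite_set Y0 := finite_separated _ q0 sX.
pose s := undup s0.
have sE : Y0 = [set` s] by rewrite s0E; apply/seteqP; split => x /=; rewrite mem_undup.
have us : uniq s by exact: undup_uniq.
pose N := size s; pose y (i : 'I_N) := nth 0 s i.
have yY i : Y0 (y i) by rewrite sE /=; exact: mem_nth.
have sumE (F : 'rV[R]_d -> R) : \sum_(xi \in Y0) F xi = \sum_(i < N) F (y i).
  by rewrite sE -fsbig_seq// (big_nth 0) big_mkord.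
have XtY t : box rw t -> Xt t `<=` Y0.
  move=> /boxP tr xi /XtX[Xxi xit]; split => //; apply/boxP => i.
  rewrite (_ : xi 0 i = t 0 i + (xi - t) 0 i); last by rewrite !mxE; lra.
  rewrite (le_trans (ler_normD _ _))// lerD//.
  exact: le_trans (coord_le_enorm _ _) xit.
have ma i : measurable_fun setT (fun t => A t (y i)).
  by have /A1 := (yY i).1 => /measurable_int/measurable_EFinP.
have mphi i : measurable_fun setT (fun x : 'rV[R]_d => Phi (x - y i)).
  exact: (measurableT_comp mPhi (@measurable_fun_translation R d (y i))).
have mPsi : measurable_fun setT (fun z : 'rV[R]_d * 'rV[R]_d => Phi (z.1 - z.2)).
  exact: (measurableT_comp mPhi (@measurable_fun_subr2 R d)).
have mEz : measurable_fun setT (fun z : 'rV[R]_d * 'rV[R]_d => Eh (z.1 - z.2)).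
  exact: (measurableT_comp measurable_error_kernel (@measurable_fun_subr2 R d)).
have cover t : box rw t -> exists Z : {set 'I_N}, forall x,
    `|Phi (x - t) - \sum_(i in Z) A t (y i) * Phi (x - y i)| <= Eh (x - t).
  move=> tr; exists [set i | `[< Xt t (y i) >]]%SET => x.
  rewrite (_ : \sum_(i in _) _ = \sum_(xi \in Xt t) A t xi * Phi (x - xi)).
    exact: (bound x t).
  have XE : Xt t = Y0 `&` Xt t by apply/esym/setIidPr/XtY.
  rewrite [in RHS]XE fsbig_mkcondr sumE big_mkcond/=; apply: eq_bigr => i _.
  by rewrite finset.inE.
have [rho [mrho rho01 rhoE]] := measurable_selection leb leb mPsi mEz mphi ma cover.
have rhoB i t : `|rho i t| <= 1.
  by have /andP[r0 r1] := rho01 i t; rewrite ger0_norm.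
pose wa i t := w t * (rho i t * A t (y i)).
have iwa i : leb.-integrable setT (EFin \o wa i).
  have wrB t : `|w t * rho i t| <= Bw by rewrite normrM -[leRHS]mulr1 ler_pM.
  have := bounded_integrableM measurableT (measurable_funM mw (mrho i)) wrB (A1 _ (yY i).1).
  by apply: eq_integrable => // t _; rewrite /wa /= mulrA.
have iwaP x i : leb.-integrable setT (EFin \o (fun t => wa i t * Phi (x - y i))).
  have := integrableZr measurableT (Phi (x - y i)) (iwa i).
  by apply: eq_integrable.
pose a xi := \sum_(i < N | y i == xi) \int[leb]_t wa i t.
exists Y0, a; split.
- by rewrite sE.
- by move=> xi [].
have aE i : a (y i) = \int[leb]_t wa i t.
  rewrite /a (big_pred1 i)// => j /=.
  by rewrite /y nth_uniq.
apply: filterS rhoE => x xE.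
rewrite sumE.
under eq_bigr do rewrite aE.
pose D t := Phi (x - t) - \sum_(i < N) rho i t * A t (y i) * Phi (x - y i).
have -> : \int[leb]_t (w t * Phi (x - t)) - \sum_(i < N) \int[leb]_t wa i t * Phi (x - y i) =
    \int[leb]_t (w t * D t).
  transitivity (\int[leb]_t (w t * Phi (x - t) - \sum_(i < N) wa i t * Phi (x - y i))); last first.
    apply: eq_Rintegral => t _; rewrite /D mulrBr; congr (_ - _); rewrite mulr_sumr.
    by apply: eq_bigr => i _; rewrite /wa !mulrA.
  rewrite RintegralB//; last first.
    by apply: integrable_Rsum => i; exact: iwaP.
  rewrite Rintegral_sum//; congr (_ - _); apply: eq_bigr => i _.
  by rewrite RintegralZr.
have iD : leb.-integrable setT (EFin \o (fun t => w t * D t)).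
  have := integrableB measurableT (iw x) (integrable_Rsum (index_enum _) (iwaP x)).
  apply: eq_integrable => // t _ /=; rewrite -EFinB; congr EFin.
  rewrite /D mulrBr; congr (_ - _); rewrite mulr_sumr.
  by apply: eq_bigr => i _; rewrite /wa !mulrA.
rewrite -lee_fin EFin_normr_Rintegral//.
have mEhx : measurable_fun setT (fun t : 'rV[R]_d => Eh (x - t)).
  exact: (measurableT_comp measurable_error_kernel (measurable_fun_reflection x)).
have mnw : measurable_fun setT (fun t => `|w t|) by exact: measurableT_comp.
apply: (le_trans (le_abse_integral _ measurableT (measurable_int _ iD))).
rewrite (abs_convolveE measurable_error_kernel error_kernel_ge0 integral_error_kernel mw wB).
have mwE : measurable_fun setT (fun y : 'rV[R]_d => (`|w (x - y)| * Eh y)%:E).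
  apply/measurable_EFinP; apply: measurable_funM; last exact: measurable_error_kernel.
  exact: (measurableT_comp mnw (measurable_fun_reflection x)).
rewrite -[leRHS](ge0_integral_reflection x)//; last first.
  by move=> z; rewrite lee_fin mulr_ge0// error_kernel_ge0.
apply: ae_ge0_le_integral => //.
- by apply: measurableT_comp => //; exact: measurable_int iD.
- by move=> t _; rewrite lee_fin mulr_ge0// error_kernel_ge0.
- exact: (measurableT_comp mwE (measurable_fun_reflection x)).
apply: filterS xE => t tE _; rewrite /= lee_fin normrM subKr.
have [->|/wsupp wt] := eqVneq (w t) 0; first by rewrite normr0 !mul0r.
by rewrite ler_wpM2l// tE.
Qed.

End quasi_interpolation.

(** * The error estimate *)

Lemma Cc_continuous (R : realType) (d k : nat) (f : 'rV[R]_d -> R) :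
  Cc k f -> continuous f.
Proof. by case=> + _; case: k => [//|k] []. Qed.

Lemma Cc_bounded (R : realType) (d k : nat) (f : 'rV[R]_d -> R) : Cc k f ->
  exists B r, (forall x, `|f x| <= B) /\ (forall x, f x != 0 -> box r x).
Proof.
by move=> fC; apply: continuous_compact_bounded; [exact: Cc_continuous fC|case: fC].
Qed.

Section error_bound.
Context (R : realType) (d : nat).
Local Notation leb := (lebesgue R d).
Local Notation L p g := (Lnorm leb p (EFin \o g)).
Variables (X : set 'rV[R]_d) (q : R) (Phi G : 'rV[R]_d -> R) (C0 l kappa CE cd : R).
Local Notation h := (hfill X).
Hypotheses (q0 : 0 < q) (sX : q_separated q X) (h0 : 0 < h).
Hypotheses (lPhi : L1loc Phi) (lG : L1loc G) (CE0 : 0 < CE) (cd0 : 0 <= cd).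
Hypothesis p2 : property2 C0 l kappa CE X Phi.
Hypothesis intdecay : (\int[leb]_x (decay l h x)%:E <= (cd * h ^+ d)%:E)%E.
Variables (mu nu : {charge set 'rV[R]_d -> \bar R}) (M : R).
Hypothesis cmu : compactly_supported mu.
Hypotheses (tvmu : (tv_norm mu <= M%:E)%E) (tvnu : (tv_norm nu <= (h `^ kappa)%:E)%E).
Hypothesis GE : eq_convolution_plus G Phi mu nu.
Variables (f u : 'rV[R]_d -> R) (B ru : R).
Hypotheses (mf : measurable_fun setT f) (fL1 : L1 f).
Hypotheses (meas_u : measurable_fun setT u) (uB : forall x, `|u x| <= B).
Hypothesis usupp : forall x, u x != 0 -> box ru x.
Hypothesis fE : forall x, (f x)%:E = (\int[leb]_t (u t * G (x - t))%:E)%E.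

(** A single [S] serves for all [p], so that the bound for [p = 1] can be used to
    show that [S] is integrable. *)
Lemma exists_approximant : exists2 S, rbf_space X Phi S &
  forall p, (1 <= p)%E ->
    (L p (f \- S)%R <= ((CE * cd * M + 1) * h `^ kappa)%:E * L p u)%E.
Proof.
have [rm [mup_supp mun_supp]] := compactly_supported_box cmu.
have mPhi : measurable_fun setT Phi by case: lPhi.
pose w t := convolve (pos_part mu) u t - convolve (neg_part mu) u t.
have mw : measurable_fun setT w.
  by apply: measurable_funB; exact: measurable_convolve.
have wmu t : `|w t| <= charge_abs_convolve mu u t by exact: norm_charge_convolve_le uB t.
have wB t : `|w t| <= B * fine (tv_norm mu).
  exact: le_trans (wmu t) (charge_abs_convolve_le _ meas_u uB t).
have wsupp t : w t != 0 -> box (ru + rm) t.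
  have [p0|/(convolve_support mup_supp meas_u usupp)//] := eqVneq (convolve (pos_part mu) u t) 0.
  have [n0|/(convolve_support mun_supp meas_u usupp)//] := eqVneq (convolve (neg_part mu) u t) 0.
  by rewrite /w p0 n0 subrr eqxx.
have iw x : leb.-integrable setT (EFin \o (fun t => w t * Phi (x - t))).
  have := integrableB measurableT
    (integrable_convolveM mup_supp lPhi meas_u uB usupp x)
    (integrable_convolveM mun_supp lPhi meas_u uB usupp x).
  by apply: eq_integrable => // t _; rewrite /= -EFinB -mulrBl.
have [Y [a [Yfin YX Yerr]]] :=
  quasi_interpolation q0 sX h0 mPhi CE0 p2 intdecay mw wB wsupp iw.
pose S x := \sum_(xi \in Y) a xi * Phi (x - xi).
pose g1 := abs_convolve leb (error_kernel X l kappa CE) w.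
pose g2 := charge_abs_convolve nu u.
have mE := measurable_error_kernel X l kappa CE.
have E0 := error_kernel_ge0 X l kappa CE0.
have iE := integral_error_kernel kappa h0 CE0 intdecay.
have mg1 : measurable_fun setT g1 by exact: (measurable_abs_convolve mE E0 iE mw wB).
have mg2 : measurable_fun setT g2 by exact: (measurable_charge_abs_convolve nu meas_u uB).
have mS : measurable_fun setT S.
  have [s sY] := (finite_seqP Y).1 Yfin.
  have -> : S = fun x => \sum_(xi <- undup s) a xi * Phi (x - xi).
    apply/funext => x; rewrite fsbig_seq ?undup_uniq//.
    by apply: eq_fsbigl; rewrite sY; apply/seteqP; split => z /=; rewrite mem_undup.
  apply: measurable_sum => xi; apply: measurable_funM => //.
  exact: (measurableT_comp mPhi (measurable_fun_translation xi)).
have err : {ae leb, forall x, `|(f \- S) x| <= g1 x + g2 x}.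
  apply: filterS Yerr => x Sx.
  have -> : (f \- S) x = (\int[leb]_t (w t * Phi (x - t)) - S x) +
     (\int[pos_part nu]_s u (x - s) - \int[neg_part nu]_s u (x - s)).
    have -> : (f \- S) x = f x - S x by [].
    have -> : f x = \int[leb]_t (u t * G (x - t)) by rewrite /Rintegral -fE.
    rewrite (reproduction_split mup_supp mun_supp lG lPhi GE meas_u uB usupp x).
    by rewrite addrAC.
  rewrite (le_trans (ler_normD _ _))// lerD//.
  exact: norm_charge_convolve_le.
have bound p : (1 <= p)%E ->
    (L p (f \- S)%R <= ((CE * cd * M + 1) * h `^ kappa)%:E * L p u)%E.
  move=> p1.
  have K0 : 0 <= CE * cd * h `^ kappa by rewrite !mulr_ge0 ?powR_ge0// ltW.
  have M0 : 0 <= M by rewrite -lee_fin (le_trans _ tvmu)// tv_normE adde_ge0.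
  have mfS : measurable_fun setT (f \- S) by exact: measurable_funB.
  have mgg : measurable_fun setT (g1 \+ g2)%R by exact: measurable_funD.
  apply: (le_trans (ae_le_Lnorm mfS mgg err p1)).
  apply: (le_trans (eminkowski _ mg1 mg2 p1)).
  have Lw : (L p w <= M%:E * L p u)%E.
    apply: (@le_trans _ _ (L p (charge_abs_convolve mu u))).
      apply: ae_le_Lnorm => //; last exact: aeW.
      exact: (measurable_charge_abs_convolve mu meas_u uB).
    apply: (le_trans (charge_young mu meas_u uB p1)).
    by rewrite lee_wpmul2r// Lnorm_ge0.
  have -> : (CE * cd * M + 1) * h `^ kappa = CE * cd * h `^ kappa * M + h `^ kappa by lra.
  rewrite EFinD ge0_muleDl; last 2 first.
  - by rewrite lee_fin mulr_ge0.
  - by rewrite lee_fin powR_ge0.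
  apply: leeD.
    apply: (le_trans (young mE E0 iE mw wB p1)).
    by rewrite [X in (_ <= X * _)%E]EFinM -muleA lee_wpmul2l// lee_fin.
  apply: (le_trans (charge_young nu meas_u uB p1)).
  by rewrite lee_wpmul2r// Lnorm_ge0.
exists S => //; split; first by exists Y, a.
have uL1 : L1 u := bounded_support_integrable meas_u uB usupp.
have L1u : (L 1%E u < +oo)%E by rewrite Lnorm1; case/integrableP : uL1.
have ifS : leb.-integrable setT (EFin \o (f \- S)).
  apply/integrableP; split; first by apply/measurable_EFinP; exact: measurable_funB.
  rewrite -Lnorm1 (le_lt_trans (bound 1%E (lexx _)))//.
  rewrite -[L 1%E u]fineK ?ge0_fin_numE ?Lnorm_ge0// -EFinM ltry//.
have := integrableB measurableT fL1 ifS.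
by apply: eq_integrable => // x _; rewrite /= -EFinB opprB addrC subrK.
Qed.

End error_bound.

Theorem theorem2p1 (R : realType) (d k : nat)
    (Phi : 'rV[R]_d -> R) (T : ('rV[R]_d -> R) -> ('rV[R]_d -> R))
    (rho0 C0 l kappa CE : R) :
  (0 < d)%N -> L1loc Phi -> radial Phi -> property1 k Phi T ->
  0 < C0 -> d%:R < l -> 0 < kappa -> 0 < CE ->
  exists2 C : R, 0 < C &
    forall X : set 'rV[R]_d,
      quasi_uniform rho0 X -> property2 C0 l kappa CE X Phi ->
    forall f : 'rV[R]_d -> R, Cc k f ->
    forall p : \bar R, (1 <= p)%E ->
      (approx_error p f X Phi <=
       (C * hfill X `^ kappa)%:E * Lnorm (lebesgue R d) p (EFin \o T f))%E.
Proof.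
move=> d0 lPhi _ [TC _ [G lG [fE [mu [nu [cmu [M tvmu] nu0 GE]]]]]] _ dl _ CE0.
have [cd cd0 intdecay] := integral_decay dl.
have M0 : 0 <= M by rewrite -lee_fin (le_trans _ (tvmu 0%N))// tv_normE adde_ge0.
exists (CE * cd * M + 1); first by rewrite ltr_pwDr// !mulr_ge0// ltW.
move=> X [_ hX qX _] p2 f fC p p1.
have h0 := hfill_gt0 d0 hX qX.
have [q q0 sX] := separation_radius_gt0 qX.
have hk0 : (0 < (hfill X `^ kappa)%:E)%E by rewrite lte_fin powR_gt0.
have : \forall n \near \oo, (tv_norm (nu n) < (hfill X `^ kappa)%:E)%E.
  exact: nu0 _ (open_ereal_lt' hk0).
move=> /filter_ex[n nun].
have [B [r [uB usupp]]] := Cc_bounded (TC f fC).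
have mTf := continuous_measurable_mx (Cc_continuous (TC f fC)).
have mf := continuous_measurable_mx (Cc_continuous fC).
have [Bf [rf [fB fsupp]]] := Cc_bounded fC.
have [S SX bound] := exists_approximant q0 sX h0 lPhi lG CE0 cd0 p2 (intdecay _ h0)
  (cmu n) (tvmu n) (ltW nun) (GE n) mf (bounded_support_integrable mf fB fsupp)
  mTf uB usupp (fE f fC).
apply: le_trans (bound p p1).
by apply: ereal_inf_lbound; exists S.
Qed.
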